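(* Let $f:\mathbb{R}_{\ge0}\to\mathbb{R}$ be a smooth function with $f(r)>0$ whenever $r>0$, let $\mathcal{L}:\mathbb{S}^n\to\mathbb{S}^m$ be an LOMSE of $(n,p,k)$-type, and let $C\in\{1,-1\}$. Put $F(r,\mathbf{x})=(r\mathbf{x},f(r)\mathcal{L}(\mathbf{x}))$ and $\Sigma=F(\mathbb{R}_{\ge0}\times\mathbb{S}^n)\subset\mathbb{R}^{n+m+2}$. Then $\Sigma$ is a self-similar solution to the mean curvature flow, i.e. $H_\Sigma=CF^\perp$ (at the points $F(r,\mathbf{x})$ with $r>0$), if and only if $f$ satisfies $$\frac{f_{rr}}{1+f_r^2}+\frac{(n-p)f_r}{r}+\frac{p(rf_r-\lambda^2f)}{r^2+\lambda^2f^2}+C(rf_r-f)=0\qquad (r>0),$$ where $\lambda=\sqrt{\frac{k(n+k-1)}{p}}$.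
   Context: Spheres are unit spheres with round metrics; $\mathbb{R}^{n+m+2}=\mathbb{R}^{n+1}\times\mathbb{R}^{m+1}$ is Euclidean; subscript $r$ denotes $d/dr$. $H_\Sigma$ is the mean curvature vector of $\Sigma$ (the trace of the second fundamental form with respect to the induced metric) and $F^\perp$ is the projection of the position vector to the normal bundle. $\Sigma$ is a self-similar solution with constant $C$ if $H_\Sigma=CF^\perp$. LOM: a smooth map $\mathcal{L}:\mathbb{S}^n\to\mathbb{S}^m$ is a Lawson-Osserman map (LOM) if there is an acute angle $\theta$ such that $M_{\mathcal{L},\theta}=\{(\mathbf{x}\cos\theta,\mathcal{L}(\mathbf{x})\sin\theta):\mathbf{x}\in\mathbb{S}^n\}$ is a minimal submanifold of $\mathbb{S}^{n+m+1}$; $M_{\mathcal{L},\theta}$ is called the associated Lawson-Osserman sphere. LOMSE: an LOM $\mathcal{L}$ whose associated Lawson-Osserman sphere $M_{\mathcal{L},\theta}$ is not totally geodesic is an LOMSE if for every $\mathbf{x}\in\mathbb{S}^n$ all non-zero singular values of the differential $(\mathcal{L}_* )_{\mathbf{x}}$ (square roots of eigenvalues of $((\mathcal{L}_* )_{\mathbf{x}})^*(\mathcal{L}_* )_{\mathbf{x}}$, with respect to the round metrics) are equal. It is known (Xu-Yang-Zhang) that then the non-zero singular value is a constant $\lambda$, $\mathcal{L}$ has constant rank $p$, all components of $\mathcal{L}=(\mathcal{L}_1,\dots,\mathcal{L}_{m+1})\in\mathbb{R}^{m+1}$ are spherical harmonic functions of a common degree $k\ge2$, and $\lambda=\sqrt{k(n+k-1)/p}$.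 Such an $\mathcal{L}$ is called an LOMSE of $(n,p,k)$-type. *)

(* Defs.v *)
From HB Require Import structures.
From mathcomp Require Import all_boot all_order all_algebra.
From mathcomp Require Import all_classical all_reals all_analysis.
From mathcomp.multinomials Require Import (canonicals, coercions) mpoly.

Set Implicit Arguments.
Unset Strict Implicit.
Unset Printing Implicit Defensive.

Import Order.TTheory GRing.Theory Num.Theory.
Import numFieldNormedType.Exports.

Local Open Scope classical_set_scope.
Local Open Scope ring_scope.

(* The norm `|x| on 'rV[R]_N is the sup norm; it is used below only through the
   topology and the differentiable structure, which are the Euclidean ones.
   All metric notions go through [dot] and [enorm]. *)
Definition dot (R : realType) (N : nat) (u v : 'rV[R]_N) : R :=
  (u *m v^T) 0 0.

Definition enorm (R : realType) (N : nat) (u : 'rV[R]_N) : R :=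
  Num.sqrt (dot u u).

(* [sphere R n] is S^n in R^(n+1). *)
Definition sphere (R : realType) (n : nat) : set 'rV[R]_n.+1 :=
  [set x | enorm x = 1].

(* C^infinity on an open set: all iterated directional derivatives are
   Frechet differentiable. *)
Definition smooth_on_open (R : realType) (V W : normedModType R)
    (U : set V) (g : V -> W) : Prop :=
  forall (vs : seq V) (x : V), U x ->
    differentiable (foldr (fun (v : V) (h : V -> W) => 'D_v h) g vs) x.

(* Smoothness on an arbitrary subset: existence of local smooth extensions. *)
Definition smooth_on (R : realType) (V W : normedModType R)
    (A : set V) (g : V -> W) : Prop :=
  forall x : V, A x -> exists (U : set V) (h : V -> W),
    [/\ open U, U x, smooth_on_open U h &
        forall y, U y -> A y -> g y = h y].

(* A smooth regular parametrization phi : U -> S, defined on an open set of R^d,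
   which is a homeomorphism onto a relatively open subset of S.  With row
   vectors, the rows of 'J phi u are the partial derivatives of phi. *)
Definition local_param (R : realType) (d N : nat) (S : set 'rV[R]_N)
    (U : set 'rV[R]_d) (phi : 'rV[R]_d -> 'rV[R]_N) : Prop :=
  [/\ open U, smooth_on_open U phi,
      forall u, U u -> row_free ('J phi u),
      exists2 V : set 'rV[R]_N, open V & phi @` U = S `&` V &
      exists2 psi : 'rV[R]_N -> 'rV[R]_d,
        forall u, U u -> psi (phi u) = u &
        {within phi @` U, continuous psi}].

(* S is, near q, a d-dimensional embedded submanifold of R^N. *)
Definition submanifold_at (R : realType) (d N : nat) (S : set 'rV[R]_N)
    (q : 'rV[R]_N) : Prop :=
  exists (U : set 'rV[R]_d) (phi : 'rV[R]_d -> 'rV[R]_N) (u : 'rV[R]_d),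
    [/\ local_param S U phi, U u & phi u = q].

(* Orthogonal projection of v onto the orthogonal complement of the row space
   of A; that complement is the row space of kermx A^T. *)
Definition normal_proj (R : realType) (k N : nat) (A : 'M[R]_(k, N))
    (v : 'rV[R]_N) : 'rV[R]_N :=
  v *m proj_mx (kermx A^T) <<A>>%MS.

Definition partial2 (R : realType) (d N : nat) (phi : 'rV[R]_d -> 'rV[R]_N)
    (u : 'rV[R]_d) (i j : 'I_d) : 'rV[R]_N :=
  'D_(delta_mx 0 i) ('D_(delta_mx 0 j) phi) u.

(* Coefficients II(d_i, d_j) of the second fundamental form in R^N. *)
Definition second_form (R : realType) (d N : nat)
    (phi : 'rV[R]_d -> 'rV[R]_N) (u : 'rV[R]_d) (i j : 'I_d) : 'rV[R]_N :=
  normal_proj ('J phi u) (partial2 phi u i j).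

(* The same for a submanifold of the unit sphere of R^N: the normal space in the
   sphere at q = phi u is the orthogonal complement of T_q S + R q. *)
Definition sphere_second_form (R : realType) (d N : nat)
    (phi : 'rV[R]_d -> 'rV[R]_N) (u : 'rV[R]_d) (i j : 'I_d) : 'rV[R]_N :=
  normal_proj (col_mx ('J phi u) (phi u)) (partial2 phi u i j).

Definition induced_metric (R : realType) (d N : nat)
    (phi : 'rV[R]_d -> 'rV[R]_N) (u : 'rV[R]_d) : 'M[R]_d :=
  'J phi u *m ('J phi u)^T.

Definition metric_trace (R : realType) (d N : nat) (g : 'M[R]_d)
    (II : 'I_d -> 'I_d -> 'rV[R]_N) : 'rV[R]_N :=
  \sum_(i < d) \sum_(j < d) invmx g i j *: II i j.

Definition mean_curvature (R : realType) (d N : nat)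
    (phi : 'rV[R]_d -> 'rV[R]_N) (u : 'rV[R]_d) : 'rV[R]_N :=
  metric_trace (induced_metric phi u) (second_form phi u).

Definition sphere_mean_curvature (R : realType) (d N : nat)
    (phi : 'rV[R]_d -> 'rV[R]_N) (u : 'rV[R]_d) : 'rV[R]_N :=
  metric_trace (induced_metric phi u) (sphere_second_form phi u).

(* S is a d-dimensional submanifold near q and H_S = C X^perp at q, where X is
   the position vector.  H_S and X^perp do not depend on the parametrization. *)
Definition self_similar_at (R : realType) (d N : nat) (C : R)
    (S : set 'rV[R]_N) (q : 'rV[R]_N) : Prop :=
  submanifold_at d S q /\
  forall (U : set 'rV[R]_d) (phi : 'rV[R]_d -> 'rV[R]_N) (u : 'rV[R]_d),
    local_param S U phi -> U u -> phi u = q ->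
    mean_curvature phi u = C *: normal_proj ('J phi u) q.

Definition minimal_in_sphere (R : realType) (d N : nat)
    (S : set 'rV[R]_N) : Prop :=
  [/\ forall q, S q -> enorm q = 1,
      forall q, S q -> submanifold_at d S q &
      forall (U : set 'rV[R]_d) (phi : 'rV[R]_d -> 'rV[R]_N),
        local_param S U phi ->
        forall u, U u -> sphere_mean_curvature phi u = 0].

Definition totally_geodesic_in_sphere (R : realType) (d N : nat)
    (S : set 'rV[R]_N) : Prop :=
  forall (U : set 'rV[R]_d) (phi : 'rV[R]_d -> 'rV[R]_N),
    local_param S U phi ->
    forall u, U u -> forall i j, sphere_second_form phi u i j = 0.

(* Maps S^n -> S^m are represented by functions on R^(n+1) of which only the
   values on the sphere matter. *)
Definition smooth_sphere_map (R : realType) (n m : nat)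
    (L : 'rV[R]_n.+1 -> 'rV[R]_m.+1) : Prop :=
  (forall x, sphere x -> sphere (L x)) /\ smooth_on (@sphere R n) L.

(* M_{L,theta} *)
Definition LO_sphere (R : realType) (n m : nat)
    (L : 'rV[R]_n.+1 -> 'rV[R]_m.+1) (theta : R) : set 'rV[R]_(n.+1 + m.+1) :=
  [set row_mx (cos theta *: x) (sin theta *: L x) | x in @sphere R n].

(* Matrix of the differential of L at x in S^n.  The 0-homogeneous extension
   y |-> L (y / |y|) does not depend on the values of L off the sphere; its
   differential at x equals L_* on x^perp = T_x S^n and vanishes on R x.
   Hence the matrix has the rank of L_*, and since its transpose takes values in
   x^perp, the transpose induces the adjoint of L_*. *)
Definition sphere_diff (R : realType) (n m : nat)
    (L : 'rV[R]_n.+1 -> 'rV[R]_m.+1) (x : 'rV[R]_n.+1) : 'M[R]_(n.+1, m.+1) :=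
  'J (fun y => L ((enorm y)^-1 *: y)) x.

(* s is a singular value of L_* at x: s >= 0 and s^2 is an eigenvalue of
   (L_* )^* L_* on T_x S^n. *)
Definition singular_value (R : realType) (n m : nat)
    (L : 'rV[R]_n.+1 -> 'rV[R]_m.+1) (x : 'rV[R]_n.+1) (s : R) : Prop :=
  0 <= s /\
  exists v : 'rV[R]_n.+1,
    [/\ v != 0, dot x v = 0 &
        v *m (sphere_diff L x *m (sphere_diff L x)^T) = s ^+ 2 *: v].

(* L is a Lawson-Osserman map, with acute angle theta. *)
Definition LOM_with_angle (R : realType) (n m : nat)
    (L : 'rV[R]_n.+1 -> 'rV[R]_m.+1) (theta : R) : Prop :=
  [/\ smooth_sphere_map L, 0 < theta < pi / 2 &
      minimal_in_sphere n (LO_sphere L theta)].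

Definition LOMSE (R : realType) (n m : nat)
    (L : 'rV[R]_n.+1 -> 'rV[R]_m.+1) : Prop :=
  (exists2 theta : R, LOM_with_angle L theta &
     ~ totally_geodesic_in_sphere n (LO_sphere L theta)) /\
  forall x, sphere x ->
    forall s t : R, singular_value L x s -> singular_value L x t ->
      s != 0 -> t != 0 -> s = t.

(* h agrees on S^n with a homogeneous harmonic polynomial of degree k. *)
Definition spherical_harmonic (R : realType) (n k : nat)
    (h : 'rV[R]_n.+1 -> R) : Prop :=
  exists P : mpoly.mpoly n.+1 R,
    [/\ P \is mpoly.ishomog1 k mpoly.mdeg,
        \sum_(i < n.+1) mpoly.mderiv i (mpoly.mderiv i P) = 0 &
        forall x, sphere x -> h x = mpoly.meval (fun i => x 0 i) P].

(* p is the rank of L_* and k the degree of the components.  The value of the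
   non-zero singular value is a consequence, not part of the definition. *)
Definition LOMSE_of_type (R : realType) (n p k m : nat)
    (L : 'rV[R]_n.+1 -> 'rV[R]_m.+1) : Prop :=
  [/\ LOMSE L,
      forall x, sphere x -> \rank (sphere_diff L x) = p,
      (2 <= k)%N &
      forall j : 'I_m.+1, spherical_harmonic k (fun x => L x 0 j)].

Definition LO_map (R : realType) (n m : nat) (f : R -> R)
    (L : 'rV[R]_n.+1 -> 'rV[R]_m.+1) (r : R) (x : 'rV[R]_n.+1) :
    'rV[R]_(n.+1 + m.+1) :=
  row_mx (r *: x) (f r *: L x).

(* The image of R_{>=0} x S^n under LO_map. *)
Definition LO_image (R : realType) (n m : nat) (f : R -> R)
    (L : 'rV[R]_n.+1 -> 'rV[R]_m.+1) : set 'rV[R]_(n.+1 + m.+1) :=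
  [set q | exists r x, [/\ 0 <= r, sphere x & q = LO_map f L r x]].

(* Main.v *)
Require Import Defs.
From HB Require Import structures.
From mathcomp Require Import all_boot all_order all_algebra.
From mathcomp Require Import all_classical all_reals all_analysis.
From mathcomp Require Import spectral sesquilinear complex ring.
From mathcomp.multinomials Require Import (canonicals, coercions) mpoly.

(** Away from the origin the image of [LO_map] is a graph: a point [(y, z)]
    with [y != 0] lies on it exactly when [z = G y], where
    [G y = f |y| *: ell y] and [ell y = L (y / |y|)] is the extension of [L]
    that is homogeneous of degree 0.  Up to a change of coordinates every local
    parametrization is therefore the map [y |-> (y, G y)], and [H = C F^perp]
    becomes the vector equation

      sum_ab g^ab D_a D_b G = C (G - D_y G),    g = 1 + DG DG^T

    ([graph_mean_curvature]).  What remains is to compute both sides at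
    [y = r x] with [|x| = 1]; the result is a multiple of [L x], and the
    multiplier is the left-hand side of the differential equation for [f].

    Three facts about [ell] at a point [x] of the sphere make this possible.
    Write [M = Dell Dell^T]; the non-zero eigenvalues of [M] are the squares of
    the non-zero singular values of the differential of [L].

    - The components of [ell] are [|y|^-k P] with [P] a harmonic polynomial that
      is homogeneous of degree [k], so [ell] is smooth off the origin, its
      Laplacian at [x] is [- k (n + k - 1) ell] ([homog_ext_laplacian]), and
      because [|ell| = 1] the trace of [M] is [k (n + k - 1)]
      ([homog_ext_energy]).

    - [M] is symmetric with a single non-zero eigenvalue and has rank [p], hence
      is [lambda^2 Q] for an orthogonal projection [Q] of trace [p]; comparing
      traces gives [lambda^2 = k (n + k - 1) / p] ([LOMSE_gram]).

    - The trace of the Hessian of [ell] over the range of [Q] is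
      [- p lambda^2 ell] ([LOMSE_range_hess]).  Here minimality is used.  The
      Lawson-Osserman sphere lies in the graph of [sin theta *: ell] over the
      sphere of radius [cos theta], and its mean curvature is a combination of
      the traces of the Hessian over the range of [Q] and over the kernel of
      [M] in the tangent space, with different weights because
      [lambda sin theta != 0].  Minimality makes that combination parallel
      to [ell]; the sum of the two traces is the Laplacian, parallel to [ell]
      too, so each trace is.  The factor is found by pairing with [ell].

    With these, the induced metric at [r x] is diagonal with respect to the
    projections on [x], on the range of [Q] and on the rest
    ([radial_graph_gram]), with entries [1 + f_r^2], [1 + lambda^2 f^2 / r^2] and
    [1], and contracting its inverse with the Hessian of [G]
    ([radial_graph_hess]) yields the equation ([graph_equation]). *)

Import Order.TTheory GRing.Theory Num.Theory.
Import numFieldNormedType.Exports.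

Local Open Scope classical_set_scope.
Local Open Scope ring_scope.

Set Implicit Arguments.
Unset Strict Implicit.
Unset Printing Implicit Defensive.

(** * Linear algebra over the reals *)

Lemma dotE (R : realType) (N : nat) (u v : 'rV[R]_N) :
  dot u v = \sum_i u 0 i * v 0 i.
Proof. by rewrite /dot mxE; apply: eq_bigr => i _; rewrite mxE. Qed.

Lemma dotC (R : realType) (N : nat) (u v : 'rV[R]_N) : dot u v = dot v u.
Proof. by rewrite !dotE; apply: eq_bigr => i _; rewrite mulrC. Qed.

Lemma dot_ge0 (R : realType) (N : nat) (u : 'rV[R]_N) : 0 <= dot u u.
Proof. by rewrite dotE sumr_ge0// => i _; rewrite -expr2 sqr_ge0. Qed.

Lemma dot_eq0 (R : realType) (N : nat) (u : 'rV[R]_N) :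
  (dot u u == 0) = (u == 0).
Proof.
apply/idP/eqP => [|->]; last by rewrite /dot mul0mx mxE.
rewrite dotE psumr_eq0; last by move=> i _; rewrite -expr2 sqr_ge0.
move=> /allP u0; apply/rowP => i; rewrite mxE; apply/eqP.
by have := u0 i (mem_index_enum i); rewrite -expr2 sqrf_eq0.
Qed.

Lemma dotZl (R : realType) (N : nat) (a : R) (u v : 'rV[R]_N) :
  dot (a *: u) v = a * dot u v.
Proof. by rewrite /dot -scalemxAl mxE. Qed.

Lemma dotZr (R : realType) (N : nat) (a : R) (u v : 'rV[R]_N) :
  dot u (a *: v) = a * dot u v.
Proof. by rewrite dotC dotZl dotC. Qed.

Lemma enorm_gt0 (R : realType) (N : nat) (y : 'rV[R]_N) :
  (0 < enorm y) = (y != 0).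
Proof. by rewrite /enorm sqrtr_gt0 lt0r dot_eq0 dot_ge0 andbT. Qed.

Lemma enorm_sqr (R : realType) (N : nat) (y : 'rV[R]_N) :
  enorm y ^+ 2 = dot y y.
Proof. by rewrite /enorm sqr_sqrtr // dot_ge0. Qed.

Lemma enormZ (R : realType) (N : nat) (t : R) (y : 'rV[R]_N) :
  0 <= t -> enorm (t *: y) = t * enorm y.
Proof.
move=> t0; rewrite /enorm dotZl dotZr mulrA sqrtrM ?mulr_ge0 //.
by rewrite -expr2 sqrtr_sqr ger0_norm.
Qed.

Lemma dot_delta (R : realType) (N : nat) (y : 'rV[R]_N) (a : 'I_N) :
  dot y (delta_mx 0 a) = y 0 a.
Proof.
rewrite dotE (bigD1 a) //= big1 ?addr0 ?mxE ?eqxx ?mulr1 // => b ba.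
by rewrite mxE (negPf ba) andbF mulr0.
Qed.

(** [u *m A *m A^T = 0] forces [|u *m A|^2 = u *m A *m A^T *m u^T = 0]. *)
Lemma mulmx_trl_eq0 (R : realType) (m n p : nat) (X : 'M[R]_(m, n))
    (A : 'M[R]_(n, p)) : X *m (A *m A^T) = 0 -> X *m A = 0.
Proof.
move=> XA0; apply/row_matrixP => i; rewrite row_mul row0; apply/eqP.
rewrite -dot_eq0 /dot trmx_mul mulmxA -(mulmxA _ A) -row_mul XA0 row0.
by rewrite mul0mx mxE.
Qed.

Lemma gram_unit (R : realType) (d N : nat) (A : 'M[R]_(d, N)) :
  row_free A -> A *m A^T \in unitmx.
Proof.
move=> Af; rewrite -row_free_unit -kermx_eq0; apply/eqP.
apply: (row_free_inj Af); rewrite mul0mx; apply: mulmx_trl_eq0.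
exact: mulmx_ker.
Qed.

(** The kernel of [A^T] is the orthogonal complement of the rows of [A], and
    over the reals the two are complementary; so the projection kills precisely
    the tangential vectors.  This turns every equation between normal
    components into a membership in the row space of the Jacobian. *)
Lemma normal_projP (R : realType) (k N : nat) (A : 'M[R]_(k, N))
    (v : 'rV[R]_N) : (normal_proj A v == 0) = (v <= A)%MS.
Proof.
have cap0 : (kermx A^T :&: <<A>> = 0)%MS.
  apply/eqP/rowV0P => w; rewrite sub_capmx genmxE => /andP[/sub_kermxP wA].
  move=> /submxP[D wD]; apply/eqP; rewrite -dot_eq0 /dot {2}wD trmx_mul.
  by rewrite mulmxA wA mul0mx mxE.
have full : (v <= kermx A^T + <<A>>)%MS.
  apply: submx_full; rewrite -sub1mx.
  rewrite -(geq_leqif (mxrank_leqif_sup (submx1 _))) mxrank1.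
  rewrite mxrank_disjoint_sum // mxrank_ker mxrank_gen mxrank_tr.
  by rewrite subnK // rank_leq_col.
rewrite /normal_proj; apply/eqP/idP => [v0|vA]; last first.
  by rewrite proj_mx_0 // genmxE.
have := add_proj_mx cap0 full; rewrite v0 add0r => <-.
apply: submx_trans (proj_mx_sub _ _ _) _; by rewrite genmxE.
Qed.

(** Factor [Q = c *m r] through its rank; idempotence gives [r *m c = 1], and
    the trace is cyclic. *)
Lemma mxtrace_idem (F : fieldType) (n : nat) (Q : 'M[F]_n) :
  Q *m Q = Q -> \tr Q = (\rank Q)%:R.
Proof.
move=> QQ.
have factor k (c : 'M[F]_(n, k)) (r : 'M[F]_(k, n)) (B : 'M[F]_(n, k))
    (B' : 'M[F]_(k, n)) :
    c *m r = Q -> r *m B = 1%:M -> B' *m c = 1%:M -> \tr Q = k%:R.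
  move=> crQ rB Bc; have rc1 : r *m c = 1%:M.
    have := congr1 (fun X => B' *m X *m B) QQ.
    by rewrite /= -crQ !mulmxA Bc mul1mx -!mulmxA rB mulmx1.
  by rewrite -crQ mxtrace_mulC rc1 mxtrace1.
have /row_freeP[B rB] := row_base_free Q.
have /row_fullP[B' Bc] := col_base_full Q.
exact: factor (mulmx_base Q) rB Bc.
Qed.

(** A real symmetric matrix becomes diagonal, with real entries, in a unitary
    basis over [R[i]], and each diagonal entry is an eigenvalue of the original
    matrix because the characteristic polynomial has real coefficients.  If all
    non-zero entries equal [a], then the diagonal matrix satisfies [d^2 = a d],
    and so does [M]. *)
Lemma sym_single_eigenvalue (R : realType) (n : nat) (M : 'M[R]_n) :
  M^T = M -> M != 0 ->
  (forall a b, eigenvalue M a -> eigenvalue M b -> a != 0 -> b != 0 -> a = b) ->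
  exists a, [/\ eigenvalue M a, a != 0 & M *m M = a *: M].
Proof.
move=> MT M0 eigM; pose Mc := map_mx (real_complex R) M.
have Mh : Mc \is hermsymmx.
  apply: realsym_hermsym.
    by apply/is_hermitianmxP; rewrite expr0 scale1r map_mx_id // map_trmx MT.
  by apply/mxOverP => i j; rewrite mxE; apply/complex_realP; exists (M i j).
have dreal := hermitian_spectral_diag_real Mh.
have Pu := spectral_unit Mc.
have /orthomx_spectralP := hermitian_normalmx Mh.
move: dreal Pu; set P := spectralmx Mc; set d := spectral_diag Mc.
move=> dreal Pu McE.
have eigd i : exists2 a, d 0 i = (real_complex R) a & eigenvalue M a.
  have /complex_realP[a da] : d 0 i \is Num.real by move/mxOverP: dreal.
  exists a => //.
  rewrite eigenvalue_root_char -(fmorph_root (real_complex R)) map_char_poly.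
  rewrite -[X in root _ X]da -eigenvalue_root_char; apply/eigenvalueP; exists (row i P).
    rewrite -row_mul -/Mc McE !mulmxA mulmxV // mul1mx row_mul.
    by rewrite row_diag_mx -scalemxAl -rowE.
  apply/eqP => /(congr1 (mulmx^~ (invmx P))); rewrite -row_mul mulmxV // mul0mx.
  by move=> /rowP/(_ i)/eqP; rewrite !mxE eqxx oner_eq0.
have [i di0] : exists i, d 0 i != 0.
  apply/existsP; apply: contraNT M0; rewrite negb_exists => /forallP d0.
  have d00 : d = 0 by apply/rowP => i; rewrite mxE; apply/eqP; rewrite -[_ == _]negbK.
  by rewrite -(map_mx_eq0 (real_complex R)) -/Mc McE d00 linear0 mulmx0 mul0mx.
have [a da ea] := eigd i.
have a0 : a != 0 by apply: contraNneq di0 => a0; rewrite da a0 rmorph0.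
exists a; split=> //.
have dd : diag_mx d *m diag_mx d = (real_complex R) a *: diag_mx d.
  rewrite mulmx_diag -linearZ; congr diag_mx; apply/rowP => j; rewrite !mxE.
  have [b db eb] := eigd j; rewrite db.
  have [->|b0] := eqVneq b 0; first by rewrite rmorph0 !mulr0.
  by rewrite (eigM _ _ ea eb a0 b0).
(* The identity holds over [R[i]], where [M] is conjugate to [diag_mx d]. *)
apply: (@map_mx_inj _ _ (real_complex R)).
rewrite map_mxM map_mxZ -/Mc McE scalemxAl scalemxAr -dd.
by rewrite !mulmxA mulmxK.
Qed.

(** * Differential calculus of maps into row vectors *)

Section RowCalculus.
Variables (R : realType) (V : normedModType R).

Lemma differentiable_row (N : nat) (F : V -> 'rV[R]_N) (x : V) :
  (forall j, differentiable (fun y => F y 0 j) x) -> differentiable F x.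
Proof.
move=> Fj; have -> : F = \sum_(j < N) (fun y => F y 0 j *: delta_mx 0 j).
  by apply/funext => y; rewrite fct_sumE; exact: row_sum_delta.
by apply: differentiable_sum => j; apply: differentiableZl.
Qed.

Lemma differentiable_entry (N : nat) (F : V -> 'rV[R]_N) (x : V) (j : 'I_N) :
  differentiable F x -> differentiable (fun y => F y 0 j) x.
Proof.
move=> dF; apply: (@differentiable_comp _ _ _ _ F (fun u : 'rV[R]_N => u 0 j)) => //.
exact: differentiable_coord.
Qed.

Lemma derive_entry (N : nat) (F : V -> 'rV[R]_N) (x v : V) (j : 'I_N) :
  differentiable F x -> ('D_v F x) 0 j = 'D_v (fun y => F y 0 j) x.
Proof. by move=> dF; rewrite derive_mx ?mxE //; apply: diff_derivable. Qed.

Lemma derive_scale (N : nat) (a : V -> R) (F : V -> 'rV[R]_N) (x v : V) :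
  differentiable a x -> differentiable F x ->
  differentiable (fun y => a y *: F y) x /\
  'D_v (fun y => a y *: F y) x = 'D_v a x *: F x + a x *: 'D_v F x.
Proof.
move=> da dF.
have daF j : differentiable (fun y => (a y *: F y) 0 j) x.
  rewrite (_ : (fun _ => _) = a * (fun y => F y 0 j)); last first.
    by apply/funext => y; rewrite !mxE.
  by apply: differentiableM => //; apply: differentiable_entry.
split; first exact: differentiable_row.
apply/rowP => j; rewrite derive_entry; last exact: differentiable_row.
rewrite (_ : (fun _ => _) = a * (fun y => F y 0 j)); last first.
  by apply/funext => y; rewrite !mxE.
have dFj := differentiable_entry j dF.
rewrite deriveM; [|exact: diff_derivable|exact: diff_derivable].
by rewrite !mxE derive_entry // addrC; congr (_ + _); rewrite /GRing.scale /= mulrC.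
Qed.

Lemma derive_chain (N : nat) (W : normedModType R) (y : V -> 'rV[R]_N)
    (G : 'rV[R]_N -> W) (x v : V) :
  differentiable y x -> differentiable G (y x) ->
  'D_v (G \o y) x = 'D_('D_v y x) G (y x).
Proof.
move=> dy dG; rewrite deriveE; last exact: differentiable_comp.
by rewrite diff_comp //= -(deriveE _ dy) -(deriveE _ dG).
Qed.

Lemma derive_comb (N : nat) (W : normedModType R) (G : 'rV[R]_N -> W)
    (x w : 'rV[R]_N) : differentiable G x ->
  'D_w G x = \sum_b w 0 b *: 'D_(delta_mx 0 b) G x.
Proof.
move=> dG; rewrite deriveE // {1}[w]row_sum_delta linear_sum.
by apply: eq_bigr => b _; rewrite linearZ deriveE.
Qed.

Lemma derive_mul (g h : V -> R) (x v : V) :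
  differentiable g x -> differentiable h x ->
  differentiable (fun y => g y * h y) x /\
  'D_v (fun y => g y * h y) x = 'D_v g x * h x + g x * 'D_v h x.
Proof.
move=> dg dh; split; first exact: (differentiableM dg dh).
rewrite (@deriveM _ _ g h); [|exact: diff_derivable|exact: diff_derivable].
by rewrite addrC /GRing.scale /= [X in X + _]mulrC.
Qed.

Lemma derive_lsubmx (N M : nat)
    (phi : V -> 'rV[R]_(N + M)) (x v : V) : differentiable phi x ->
  differentiable (fun w => lsubmx (phi w)) x /\
  'D_v (fun w => lsubmx (phi w)) x = lsubmx ('D_v phi x).
Proof.
move=> dphi; have dl : differentiable (fun w => lsubmx (phi w)) x.
  exact: (differentiable_comp dphi (differentiable_lsubmx _)).
split=> //; apply/rowP => j; rewrite derive_entry // [RHS]mxE derive_entry //.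
have -> // : (fun w => lsubmx (phi w) 0 j) = (fun w => phi w 0 (lshift M j)).
by apply/funext => w; rewrite mxE.
Qed.

Lemma derive_rsubmx (N M : nat)
    (phi : V -> 'rV[R]_(N + M)) (x v : V) : differentiable phi x ->
  differentiable (fun w => rsubmx (phi w)) x /\
  'D_v (fun w => rsubmx (phi w)) x = rsubmx ('D_v phi x).
Proof.
move=> dphi; have dl : differentiable (fun w => rsubmx (phi w)) x.
  exact: (differentiable_comp dphi (differentiable_rsubmx _)).
split=> //; apply/rowP => j; rewrite derive_entry // [RHS]mxE derive_entry //.
have -> // : (fun w => rsubmx (phi w) 0 j) = (fun w => phi w 0 (rshift N j)).
by apply/funext => w; rewrite mxE.
Qed.

End RowCalculus.

Lemma jacobianE (R : realType) (d N : nat) (F : 'rV[R]_d -> 'rV[R]_N)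
    (x : 'rV[R]_d) i j : differentiable F x ->
  'J F x i j = 'D_(delta_mx 0 i) F x 0 j.
Proof. by move=> dF; rewrite deriveEjacobian // -rowE [RHS]mxE. Qed.

(** The Hessian of [G] at [y] contracted with a bilinear form: the Laplacian
    for [S = 1%:M], the second derivative along [x] for [S = x^T *m x], the
    trace over a subspace when [S] is the projection on it. *)
Definition hess_contr (R : realType) (N M : nat) (S : 'M[R]_N)
    (G : 'rV[R]_N -> 'rV[R]_M) (y : 'rV[R]_N) : 'rV[R]_M :=
  \sum_a \sum_b S a b *: partial2 G y a b.

Lemma hess_contrB (R : realType) (N M : nat) (S T : 'M[R]_N)
    (G : 'rV[R]_N -> 'rV[R]_M) (y : 'rV[R]_N) :
  hess_contr (S - T) G y = hess_contr S G y - hess_contr T G y.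
Proof.
rewrite /hess_contr -sumrB; apply: eq_bigr => a _; rewrite -sumrB.
by apply: eq_bigr => b _; rewrite !mxE scalerBl.
Qed.

Lemma hess_contrZ (R : realType) (N M : nat) (c : R) (S : 'M[R]_N)
    (G : 'rV[R]_N -> 'rV[R]_M) (y : 'rV[R]_N) :
  hess_contr (c *: S) G y = c *: hess_contr S G y.
Proof.
rewrite /hess_contr scaler_sumr; apply: eq_bigr => a _; rewrite scaler_sumr.
by apply: eq_bigr => b _; rewrite !mxE scalerA.
Qed.

Lemma hess_contr1 (R : realType) (N M : nat) (G : 'rV[R]_N -> 'rV[R]_M) (y : 'rV[R]_N) :
  hess_contr 1%:M G y = \sum_a partial2 G y a a.
Proof.
apply: eq_bigr => a _; rewrite (bigD1 a) //= big1 ?addr0 ?mxE ?eqxx ?scale1r // => b ba.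
by rewrite mxE eq_sym (negPf ba) scale0r.
Qed.

(** Together with the second derivative of [y] itself, the last term forms a
    vector tangent to the graph of [G]; this is why the mean curvature does not
    depend on the parametrization. *)
Lemma partial2_comp (R : realType) (d N M : nat) (y : 'rV[R]_d -> 'rV[R]_N)
    (G : 'rV[R]_N -> 'rV[R]_M) (u : 'rV[R]_d) (i j : 'I_d) :
  (\forall w \near u, differentiable y w /\ differentiable G (y w)) ->
  differentiable ('D_(delta_mx 0 j) y) u ->
  (forall b, differentiable ('D_(delta_mx 0 b) G) (y u)) ->
  partial2 (G \o y) u i j =
    \sum_a \sum_b ('J y u i a * 'J y u j b) *: partial2 G (y u) a b
    + partial2 y u i j *m 'J G (y u).
Proof.
move=> dyG dDy dDG; have [dy dG] := nbhs_singleton dyG.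
rewrite /partial2.
rewrite (@near_eq_derive _ _ _ _ (\sum_b (fun w => 'D_(delta_mx 0 j) y w 0 b *:
    ('D_(delta_mx 0 b) G \o y) w))); last first.
  near=> w; have [dyw dGw] : differentiable y w /\ differentiable G (y w).
    by near: w.
  by rewrite derive_chain // derive_comb // fct_sumE.
have dw b : differentiable (('D_(delta_mx 0 b) G) \o y) u.
  exact: differentiable_comp.
have dc b : differentiable (fun w => 'D_(delta_mx 0 j) y w 0 b) u.
  exact: differentiable_entry.
rewrite derive_sum; last first.
  by move=> b; apply: diff_derivable; apply: (derive_scale 0 (dc b) (dw b)).1.
have Ed b : 'D_(delta_mx 0 i) (fun w => 'D_(delta_mx 0 j) y w 0 b) u
    = 'D_(delta_mx 0 i) ('D_(delta_mx 0 j) y) u 0 b by rewrite derive_entry.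
rewrite -[X in _ = _ + X]deriveEjacobian // derive_comb // exchange_big -big_split /=.
apply: eq_bigr => b _; rewrite (derive_scale _ (dc b) (dw b)).2 addrC.
congr (_ + _); first by rewrite Ed.
rewrite (derive_chain _ dy (dDG b)) (derive_comb _ (dDG b)) scaler_sumr; apply: eq_bigr => a _.
by rewrite scalerA !jacobianE // mulrC.
Unshelve. all: by end_near. Qed.

Lemma open_neq0 (R : realType) (N : nat) : open [set y : 'rV[R]_N | y != 0].
Proof.
rewrite (_ : [set y | _] = ~` [set 0]); last first.
  by apply/seteqP; split => y /= /eqP.
apply: closed_openC.
exact: accessible_closed_set1 (hausdorff_accessible (@norm_hausdorff _ _)) _.
Qed.

Lemma derive_dot (R : realType) (V : normedModType R) (N : nat)
    (F G : V -> 'rV[R]_N) (x v : V) :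
  differentiable F x -> differentiable G x ->
  differentiable (fun y => dot (F y) (G y)) x /\
  'D_v (fun y => dot (F y) (G y)) x = dot ('D_v F x) (G x) + dot (F x) ('D_v G x).
Proof.
move=> dF dG.
have -> : (fun y => dot (F y) (G y)) = \sum_(j < N) ((fun y => F y 0 j) * (fun y => G y 0 j)).
  by apply/funext => y; rewrite dotE fct_sumE.
have dFj j := differentiable_entry j dF; have dGj j := differentiable_entry j dG.
have dFG j : differentiable ((fun y => F y 0 j) * (fun y => G y 0 j)) x.
  exact: differentiableM.
split; first exact: differentiable_sum.
rewrite derive_sum; last by move=> j; apply: diff_derivable.
rewrite !dotE -big_split; apply: eq_bigr => j _.
rewrite deriveM; [|exact: diff_derivable|exact: diff_derivable].
by rewrite -!derive_entry // addrC; congr (_ + _); rewrite /GRing.scale /= mulrC.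
Qed.

Lemma derive_enorm (R : realType) (N : nat) (y v : 'rV[R]_N) : y != 0 ->
  differentiable (@enorm R N) y /\ 'D_v (@enorm R N) y = (enorm y)^-1 * dot y v.
Proof.
move=> y0; have dy0 : 0 < dot y y by rewrite lt0r dot_eq0 y0 dot_ge0.
have di : differentiable (@id 'rV[R]_N) y by exact: ex_diff.
have [dd De] := derive_dot v di di.
have Ds := is_derive1_sqrt dy0.
have ds : differentiable (@Num.sqrt R) (dot y y) by apply/derivable1_diffP; case: Ds.
have -> : @enorm R N = @Num.sqrt R \o (fun u => dot u u) by [].
split; first exact: differentiable_comp.
rewrite deriveE; last exact: differentiable_comp.
rewrite diff_comp //= -(deriveE _ dd) De diff1E // derive1E (@derive_val _ _ _ _ _ _ _ Ds).
rewrite derive_id [dot v y]dotC -/(enorm y) /GRing.scale /= invfM.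
by field; rewrite gt_eqF // enorm_gt0.
Qed.

(** * Smoothness away from the origin *)

(** Near a positive point the iterated derivatives of [f] agree with those of a
    local smooth extension, the half-line being open there. *)
Lemma smooth_on_derive1n (R : realType) (f : R -> R) :
  smooth_on [set r : R | 0 <= r] f ->
  forall (i : nat) (r : R), 0 < r -> differentiable (f^`(i)%classic) r.
Proof.
move=> fs i r r0; have [U [h [oU Ur hs fh]]] := fs r (ltW r0).
have E j s : U s -> 0 < s ->
    f^`(j)%classic s = foldr (fun (v : R) (g : R -> R) => 'D_v g) h (nseq j 1) s.
  elim: j s => [|j IH] s Us s0 /=; first by apply: fh => //; exact: ltW.
  rewrite [LHS]derive1E; apply: near_eq_derive.
  by near=> z; apply: IH; near: z; [exact: open_nbhs_nbhs|exact: lt_nbhsr].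
apply/derivable1_diffP.
apply: (@near_eq_derivable _ _ _ (foldr (fun (v : R) (g : R -> R) => 'D_v g) h (nseq i 1))).
  by near=> z; apply/esym/E; near: z; [exact: open_nbhs_nbhs|exact: lt_nbhsr].
by apply/derivable1_diffP/hs.
Unshelve. all: by end_near. Qed.

Lemma differentiable_derive1n_cst (R : realType) (s : R) (i : nat) (r : R) :
  differentiable ((cst s : R -> R)^`(i)%classic) r.
Proof.
have [t ->] : exists t, (cst s : R -> R)^`(i)%classic = cst t; last exact: ex_diff.
elim: i => [|i [t IH]]; first by exists s.
by exists 0; rewrite derive1nS IH; apply/funext => z; rewrite derive1_cst.
Qed.

(** An algebra of functions off the origin that contains all components of the
    maps below and is stable under directional derivatives, since
    [D_v |y| = |y|^-1 <y, v>].  Hence its members are smooth as soon as they are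
    differentiable. *)
Inductive radial_alg (R : realType) (N : nat) (f : R -> R) : ('rV[R]_N -> R) -> Prop :=
| RadCst c : radial_alg f (cst c)
| RadCoord i : radial_alg f (fun y => y 0 i)
| RadInv : radial_alg f (fun y => (enorm y)^-1)
| RadProfile i : radial_alg f (fun y => f^`(i)%classic (enorm y))
| RadAdd g h : radial_alg f g -> radial_alg f h -> radial_alg f (fun y => g y + h y)
| RadMul g h : radial_alg f g -> radial_alg f h -> radial_alg f (fun y => g y * h y)
| RadExt g h : (forall y, y != 0 -> g y = h y) -> radial_alg f h -> radial_alg f g.

Lemma near_neq0 (R : realType) (N : nat) (y : 'rV[R]_N) (P : 'rV[R]_N -> Prop) :
  y != 0 -> (forall z, z != 0 -> P z) -> \forall z \near y, P z.
Proof.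
move=> y0 HP; near=> z; apply: HP; near: z.
by apply: open_nbhs_nbhs; split => //; exact: open_neq0.
Unshelve. all: by end_near. Qed.

Lemma eq_neq0_derive (R : realType) (N : nat) (W : normedModType R)
    (g h : 'rV[R]_N -> W) (y v : 'rV[R]_N) : (forall z, z != 0 -> g z = h z) ->
  y != 0 -> 'D_v g y = 'D_v h y.
Proof. by move=> gh y0; apply: near_eq_derive; exact: near_neq0. Qed.

(** The differential of [h] also serves as an expansion of [g] at [y]. *)
Lemma near_eq_diff (R : realType) (V W : normedModType R)
    (g h : V -> W) (y : V) : (\near y, g y = h y) ->
  differentiable h y -> differentiable g y.
Proof.
move=> gh /diff_locallyP [ch hE].
have gE : g \o shift y = cst (g y) + 'd h y +o_ 0 id.
  apply/eqaddoP => e e0; move/eqaddoP: hE => /(_ e e0) hE.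
  near=> z; have -> : ((g \o shift y) - (cst (g y) + 'd h y)) z =
      ((h \o shift y) - (cst (h y) + 'd h y)) z.
    rewrite !fctE /=; congr (_ - (_ + _)); last exact: nbhs_singleton gh.
    by rewrite addrC; near: z; move/nbhs0P: gh.
  by near: z.
apply/diff_locallyP; have -> : 'd g y = 'd h y :> (V -> W) by apply: diff_unique.
by split.
Unshelve. all: by end_near. Qed.

Lemma radial_alg_sum (R : realType) (N : nat) (f : R -> R) (I : Type) (s : seq I)
    (F : I -> 'rV[R]_N -> R) : (forall i, radial_alg f (F i)) ->
  radial_alg f (fun y => \sum_(i <- s) F i y).
Proof.
move=> HF; elim: s => [|i s IH].
  by apply: (RadExt (h := cst 0)) => [y _|]; [rewrite big_nil|exact: RadCst].
apply: (RadExt (h := fun y => F i y + \sum_(j <- s) F j y)) => [y _|].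
  by rewrite big_cons.
exact: RadAdd.
Qed.

Lemma radial_alg_exp (R : realType) (N : nat) (f : R -> R) (g : 'rV[R]_N -> R) q :
  radial_alg f g -> radial_alg f (fun y => g y ^+ q).
Proof.
move=> gR; elim: q => [|q IH].
  by apply: (@RadExt _ _ _ _ (cst 1)) => [y _|]; [rewrite expr0|exact: RadCst].
apply: (@RadExt _ _ _ _ (fun y => g y * g y ^+ q)) => [y _|]; last exact: RadMul.
by rewrite exprS.
Qed.

Lemma radial_alg_diff (R : realType) (N : nat) (f : R -> R) (g : 'rV[R]_N -> R) :
  (forall (i : nat) (r : R), 0 < r -> differentiable (f^`(i)%classic) r) ->
  radial_alg f g ->
  (forall y, y != 0 -> differentiable g y) /\
  (forall v, radial_alg f ('D_v g)).
Proof.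
move=> fs; elim => {g} [c|i||i|g h _ [dg Dg] _ [dh Dh]|g h Hg [dg Dg] Hh [dh Dh]
  |g h gh _ [dh Dh]].
- split=> [y _|v]; first exact: ex_diff.
  by apply: (RadExt (h := cst 0)) => [y _|]; [rewrite derive_cst|exact: RadCst].
- have di y : differentiable (@id 'rV[R]_N) y by exact: ex_diff.
  split=> [y _|v]; first exact: (differentiable_entry i (di y)).
  apply: (RadExt (h := cst (v 0 i))) => [y _|]; last exact: RadCst.
  by rewrite -(derive_entry v i (di y)) derive_id.
- have dV y : y != 0 -> differentiable (fun y : 'rV[R]_N => (enorm y)^-1) y.
    move=> y0; apply: (@differentiableV _ _ (@enorm R N)).
      exact: (derive_enorm 0 y0).1.
    by rewrite gt_eqF // enorm_gt0.
  split=> // v.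
  pose e (y : 'rV[R]_N) := (enorm y)^-1.
  apply: (RadExt (h := fun y =>
      cst (-1) y * (e y * (e y * (e y * \sum_i y 0 i * cst (v 0 i) y))))).
    move=> y y0; have [dn Dn] := derive_enorm v y0.
    rewrite (@deriveV _ _ (@enorm R N)) //.
    - rewrite Dn dotE /GRing.scale /= /e /cst; field.
      by rewrite gt_eqF // enorm_gt0.
    - by rewrite gt_eqF // enorm_gt0.
    - exact: diff_derivable.
  have Re : radial_alg f e by exact: RadInv.
  apply: RadMul; first exact: RadCst.
  do 3 (apply: RadMul => //).
  by apply: radial_alg_sum => i; apply: RadMul; [exact: RadCoord|exact: RadCst].
- have dfe y : y != 0 -> differentiable (f^`(i)%classic \o @enorm R N) y.
    move=> y0; apply: differentiable_comp; first exact: (derive_enorm 0 y0).1.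
    by apply: fs; rewrite enorm_gt0.
  split=> // v.
  apply: (RadExt (h := fun y => f^`(i.+1)%classic (enorm y) *
      ((enorm y)^-1 * \sum_i y 0 i * cst (v 0 i) y))).
    move=> y y0; have [dn Dn] := derive_enorm v y0.
    rewrite deriveE; last exact: dfe.
    have dfi : differentiable (f^`(i)%classic) (enorm y) by apply: fs; rewrite enorm_gt0.
    rewrite (@diff_comp _ _ _ _ (@enorm R N)) //= -(deriveE _ dn) Dn diff1E //.
    by rewrite dotE /GRing.scale /= mulrC.
  apply: RadMul; first exact: RadProfile.
  apply: RadMul; first exact: RadInv.
  by apply: radial_alg_sum => j; apply: RadMul; [exact: RadCoord|exact: RadCst].
- split=> [y y0|v]; first exact: (differentiableD (dg y y0) (dh y y0)).
  apply: (RadExt (h := fun y => 'D_v g y + 'D_v h y)) => [y y0|]; last exact: RadAdd.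
  by rewrite (@deriveD _ _ _ g h) //; apply: diff_derivable; auto.
- split=> [y y0|v]; first exact: (differentiableM (dg y y0) (dh y y0)).
  apply: (RadExt (h := fun y => g y * 'D_v h y + h y * 'D_v g y)) => [y y0|].
    by rewrite (@deriveM _ _ g h) //; apply: diff_derivable; auto.
  by apply: RadAdd; apply: RadMul.
- split=> [y y0|v].
    by apply: near_eq_diff (dh y y0); exact: near_neq0.
  by apply: RadExt (Dh v) => y y0; exact: eq_neq0_derive.
Qed.

(** By [radial_alg_diff] the components of all iterated derivatives stay in the
    algebra, and its members are differentiable. *)
Lemma smooth_radial_row (R : realType) (N M : nat) (f : R -> R)
    (g : 'rV[R]_N -> 'rV[R]_M) :
  (forall (i : nat) (r : R), 0 < r -> differentiable (f^`(i)%classic) r) ->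
  (forall j, radial_alg f (fun y => g y 0 j)) ->
  smooth_on_open [set y | y != 0] g.
Proof.
move=> fs gR vs; suff : forall j, radial_alg f (fun y => foldr
    (fun (v : 'rV[R]_N) (h : 'rV[R]_N -> 'rV[R]_M) => 'D_v h) g vs y 0 j).
  move=> H x x0; apply: differentiable_row => j.
  exact: (radial_alg_diff fs (H j)).1.
elim: vs => [//|v vs IH] j /=.
have [_ Dv] := radial_alg_diff fs (IH j).
apply: RadExt (Dv v) => y y0; apply: derive_entry.
apply: differentiable_row => i; exact: (radial_alg_diff fs (IH i)).1.
Qed.

(** * Polynomial functions *)

(** Induction over the ring operations instead of over monomials: both the
    derivation rule and membership in [radial_alg] are compatible with sums and
    products. *)
Lemma mpoly_generated (R : comNzRingType) (n : nat) (K : mpoly.mpoly n R -> Prop) :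
  (forall c, K (mpoly.mpolyC n c)) -> (forall i, K (mpoly.mpolyX R (mpoly.mnm1 i))) ->
  (forall P Q, K P -> K Q -> K (P + Q)) -> (forall P Q, K P -> K Q -> K (P * Q)) ->
  forall P, K P.
Proof.
move=> KC KX KD KM; apply: mpoly.mpolyind => [|c m P _ _ KP].
  by rewrite -mpoly.mpolyC0; exact: KC.
apply: KD => //; rewrite -mpoly.mul_mpolyC; apply: (KM); first exact: KC.
rewrite mpoly.mpolyXE_id; elim/big_ind: _ => [||i _]; [|exact: KM|].
  by rewrite -mpoly.mpolyC1; exact: KC.
elim: (m i) => [|q IH]; first by rewrite expr0 -mpoly.mpolyC1; exact: KC.
by rewrite exprS; apply: KM.
Qed.

Definition mpoly_fun (R : realType) (N : nat) (P : mpoly.mpoly N R) (y : 'rV[R]_N) : R :=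
  mpoly.meval (fun i => y 0 i) P.

Lemma derive_mpoly_fun (R : realType) (N : nat) (P : mpoly.mpoly N R) (y : 'rV[R]_N) :
  differentiable (mpoly_fun P) y /\
  forall a, 'D_(delta_mx 0 a) (mpoly_fun P) y = mpoly_fun (mpoly.mderiv a P) y.
Proof.
elim/mpoly_generated: P => [c|i|P Q [dP DP] [dQ DQ]|P Q [dP DP] [dQ DQ]].
- have -> : mpoly_fun (mpoly.mpolyC N c) = cst c.
    by apply/funext => z; rewrite /mpoly_fun mpoly.mevalC.
  split=> [|a]; first exact: ex_diff.
  by rewrite derive_cst mpoly.mderivC /mpoly_fun mpoly.meval0.
- have -> : mpoly_fun (mpoly.mpolyX R (mpoly.mnm1 i)) = (fun z : 'rV[R]_N => z 0 i).
    by apply/funext => z; rewrite /mpoly_fun mpoly.mevalXU.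
  have di : differentiable (@id 'rV[R]_N) y by exact: ex_diff.
  split=> [|a]; first exact: (differentiable_entry i di).
  rewrite -(derive_entry _ i di) derive_id mxE eqxx mpoly.mderivX /mpoly_fun.
  rewrite mpoly.mevalZ mpoly.mnm1E eq_sym; have [->|] := eqVneq i a; last by rewrite mul0r.
  have -> : mpoly.mnm_sub (mpoly.mnm1 a) (mpoly.mnm1 a) = mpoly.mnm0 :> mpoly.multinom N.
    by apply/mpoly.mnmP => j; rewrite mpoly.mnmBE mpoly.mnm0E subnn.
  by rewrite mpoly.mpolyX0 mpoly.meval1 mulr1.
- have -> : mpoly_fun (P + Q) = mpoly_fun P + mpoly_fun Q.
    by apply/funext => z; rewrite /mpoly_fun mpoly.mevalD.
  split=> [|a]; first exact: differentiableD.
  rewrite deriveD; [|exact: diff_derivable|exact: diff_derivable].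
  by rewrite DP DQ /mpoly_fun mpoly.mderivD mpoly.mevalD.
- have -> : mpoly_fun (P * Q) = mpoly_fun P * mpoly_fun Q.
    by apply/funext => z; rewrite /mpoly_fun mpoly.mevalM.
  split=> [|a]; first exact: differentiableM.
  rewrite deriveM; [|exact: diff_derivable|exact: diff_derivable].
  rewrite DP DQ /mpoly_fun mpoly.mderivM mpoly.mevalD !mpoly.mevalM addrC.
  by rewrite /GRing.scale /= [X in X + _]mulrC.
Qed.

Lemma radial_alg_mpoly (R : realType) (N : nat) (f : R -> R) (P : mpoly.mpoly N R) :
  radial_alg f (mpoly_fun P).
Proof.
elim/mpoly_generated: P => [c|i|P Q HP HQ|P Q HP HQ].
- apply: (RadExt (h := cst c)); last exact: RadCst.
  by move=> z _; rewrite /mpoly_fun mpoly.mevalC.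
- apply: RadExt (RadCoord f i) => z _; by rewrite /mpoly_fun mpoly.mevalXU.
- apply: RadExt (RadAdd HP HQ) => z _; by rewrite /mpoly_fun mpoly.mevalD.
- apply: RadExt (RadMul HP HQ) => z _; by rewrite /mpoly_fun mpoly.mevalM.
Qed.

Lemma mpoly_funZ (R : realType) (N k : nat) (P : mpoly.mpoly N R) (t : R) (y : 'rV[R]_N) :
  P \is mpoly.ishomog1 k mpoly.mdeg ->
  mpoly_fun P (t *: y) = t ^+ k * mpoly_fun P y.
Proof.
move=> /mpoly.dhomogP hP; rewrite /mpoly_fun !mpoly.mevalE mulr_sumr.
apply: eq_big_seq => m /hP mk; rewrite mulrCA; congr (_ * _).
rewrite -mk /= mpoly.mdegE -prodrXr -big_split /=; apply: eq_bigr => i _.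
by rewrite mxE exprMn.
Qed.

(** * The homogeneous extension of a map between spheres *)

Lemma sphere_neq0 (R : realType) (n : nat) (x : 'rV[R]_n.+1) : sphere x -> x != 0.
Proof. by rewrite -enorm_gt0 /sphere /= => ->; exact: ltr01. Qed.

Lemma sphere_normalize (R : realType) (n : nat) (y : 'rV[R]_n.+1) :
  y != 0 -> sphere ((enorm y)^-1 *: y).
Proof.
move=> y0; rewrite /sphere /= enormZ ?invr_ge0 ?sqrtr_ge0 // mulVf //.
by rewrite gt_eqF // enorm_gt0.
Qed.

Lemma dot_sphere (R : realType) (n : nat) (x : 'rV[R]_n.+1) : sphere x -> dot x x = 1.
Proof. by rewrite /sphere /= -enorm_sqr => ->; rewrite expr1n. Qed.

(** [sphere_diff L] is by definition the Jacobian of this map. *)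
Definition homog_ext (R : realType) (n m : nat) (L : 'rV[R]_n.+1 -> 'rV[R]_m.+1)
  (y : 'rV[R]_n.+1) : 'rV[R]_m.+1 := L ((enorm y)^-1 *: y).

Lemma homog_ext_sphere (R : realType) (n m : nat) (L : 'rV[R]_n.+1 -> 'rV[R]_m.+1) x :
  sphere x -> homog_ext L x = L x.
Proof. by move=> x1; rewrite /homog_ext x1 invr1 scale1r. Qed.

Lemma homog_extZ (R : realType) (n m : nat) (L : 'rV[R]_n.+1 -> 'rV[R]_m.+1) t y :
  0 < t -> homog_ext L (t *: y) = homog_ext L y.
Proof.
move=> t0; rewrite /homog_ext enormZ ?ltW // scalerA invfM mulrAC mulVf ?mul1r //.
by rewrite gt_eqF.
Qed.

Lemma derive_scaled_arg (R : realType) (N : nat) (W : normedModType R)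
    (g : 'rV[R]_N -> W) (t : R) (y v : 'rV[R]_N) :
  differentiable g (t *: y) ->
  'D_v (fun z => g (t *: z)) y = t *: 'D_v g (t *: y).
Proof.
move=> dg; have dt : differentiable (fun z : 'rV[R]_N => t *: z) y by exact: ex_diff.
rewrite (derive_chain v dt dg) (deriveE v dt) (deriveE _ dg) diff_val.
by rewrite (deriveE _ dg) linearZ.
Qed.

Section SphericalMap.
Variables (R : realType) (n m k : nat) (L : 'rV[R]_n.+1 -> 'rV[R]_m.+1).
Hypothesis L_sphere : forall x, sphere x -> sphere (L x).
Hypothesis L_harm : forall j, spherical_harmonic k (fun x => L x 0 j).
Local Notation ell := (homog_ext L).

Lemma homog_ext_entry j : exists2 P : mpoly.mpoly n.+1 R,
  \sum_(i < n.+1) mpoly.mderiv i (mpoly.mderiv i P) = 0 &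
  forall y, y != 0 -> ell y 0 j = (enorm y)^-1 ^+ k * mpoly_fun P y.
Proof.
have [P [Pk Ph LP]] := L_harm j; exists P => // y y0.
by rewrite /homog_ext (LP _ (sphere_normalize y0)) -(mpoly_funZ _ _ Pk).
Qed.

Lemma homog_ext_alg (f : R -> R) j : radial_alg f (fun y => ell y 0 j).
Proof.
have [P _ PE] := homog_ext_entry j.
apply: (@RadExt _ _ _ _ (fun y => (enorm y)^-1 ^+ k * mpoly_fun P y)); first exact: PE.
by apply: RadMul; [apply: radial_alg_exp; exact: RadInv|exact: radial_alg_mpoly].
Qed.


Lemma homog_ext_smooth : smooth_on_open [set y | y != 0] ell.
Proof.
apply: (@smooth_radial_row _ _ _ (cst 0)); last exact: homog_ext_alg.
by move=> i r _; exact: differentiable_derive1n_cst.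
Qed.

Lemma homog_ext_diff (y : 'rV[R]_n.+1) : y != 0 -> differentiable ell y.
Proof. exact: (homog_ext_smooth [::]). Qed.

Lemma homog_ext_diff2 v (y : 'rV[R]_n.+1) : y != 0 -> differentiable ('D_v ell) y.
Proof. exact: (homog_ext_smooth [:: v]). Qed.

Lemma homog_ext_deriveZ (t : R) v (y : 'rV[R]_n.+1) : 0 < t -> y != 0 ->
  'D_v ell y = t *: 'D_v ell (t *: y).
Proof.
move=> t0 y0; rewrite -derive_scaled_arg; last first.
  by apply: homog_ext_diff; rewrite scaler_eq0 negb_or gt_eqF.
have -> : (fun z => ell (t *: z)) = ell by apply/funext => z; rewrite homog_extZ.
by [].
Qed.

Lemma homog_ext_derive2Z (t : R) v w (y : 'rV[R]_n.+1) : 0 < t -> y != 0 ->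
  'D_v ('D_w ell) y = t ^+ 2 *: 'D_v ('D_w ell) (t *: y).
Proof.
move=> t0 y0; have ty0 : t *: y != 0 by rewrite scaler_eq0 negb_or gt_eqF.
rewrite (@eq_neq0_derive _ _ _ _ (t *: (fun z => 'D_w ell (t *: z)))) //; last first.
  by move=> z z0; rewrite (homog_ext_deriveZ _ t0 z0).
have d2 := homog_ext_diff2 w ty0.
rewrite deriveZ; last first.
  have dt : differentiable (fun z : 'rV[R]_n.+1 => t *: z) y by exact: ex_diff.
  by apply: diff_derivable; exact: (differentiable_comp dt d2).
by rewrite (derive_scaled_arg v d2) scalerA.
Qed.

(** [homog_ext L] is constant along the ray through [y]. *)
Lemma homog_ext_euler (y : 'rV[R]_n.+1) : y != 0 -> y *m 'J ell y = 0.
Proof.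
move=> y0; have dl := homog_ext_diff y0; rewrite -deriveEjacobian //.
pose c (s : R) : 'rV[R]_n.+1 := s *: y.
have dc : differentiable c (1 : R) by exact: ex_diff.
have Dc : 'D_1 c 1 = y by rewrite deriveE // diff_val scale1r.
have c1 : c 1 = y by rewrite /c scale1r.
have := derive_chain (1 : R) dc; rewrite c1 => /(_ _ ell dl); rewrite Dc => <-.
rewrite (@near_eq_derive _ _ _ _ (cst (ell y))) ?derive_cst //.
near=> s; rewrite /= homog_extZ //; near: s; exact: lt_nbhsr.
Unshelve. all: by end_near. Qed.

(** Differentiate Euler's relation [\sum_b y_b D_b ell = 0] in the direction
    [y]; the terms that arise from [D_y y_b = y_b] vanish by the relation
    itself. *)
Lemma homog_ext_euler2 (y : 'rV[R]_n.+1) : y != 0 ->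
  \sum_a \sum_b (y 0 a * y 0 b) *: partial2 ell y a b = 0.
Proof.
move=> y0; have dl := homog_ext_diff y0.
have : 'D_y (\sum_b (fun z : 'rV[R]_n.+1 => z 0 b *: 'D_(delta_mx 0 b) ell z)) y = 0.
  rewrite (@near_eq_derive _ _ _ _ (cst 0)) ?derive_cst //.
  apply: near_neq0 y0 _ => z z0; rewrite fct_sumE /= -derive_comb; last exact: homog_ext_diff.
  by rewrite deriveEjacobian ?homog_ext_euler //; exact: homog_ext_diff.
have di : differentiable (@id 'rV[R]_n.+1) y by exact: ex_diff.
have D b := derive_scale y (differentiable_entry b di) (homog_ext_diff2 (delta_mx 0 b) y0).
rewrite derive_sum; last by move=> b; apply: diff_derivable; exact: (D b).1.
under eq_bigr => b _ do rewrite (D b).2 -(derive_entry y b di) derive_id.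
rewrite big_split /= -derive_comb // deriveEjacobian // homog_ext_euler // add0r => H.
rewrite -[RHS]H exchange_big; apply: eq_bigr => b _.
rewrite (derive_comb _ (homog_ext_diff2 _ y0)) scaler_sumr; apply: eq_bigr => a _.
by rewrite scalerA mulrC.
Qed.

Lemma dot_homog_ext (y : 'rV[R]_n.+1) : y != 0 -> dot (ell y) (ell y) = 1.
Proof. by move=> y0; apply: dot_sphere; apply: L_sphere; exact: sphere_normalize. Qed.

Lemma dot_homog_ext_derive v (y : 'rV[R]_n.+1) : y != 0 -> dot (ell y) ('D_v ell y) = 0.
Proof.
move=> y0; have dl := homog_ext_diff y0.
have [_] := derive_dot v dl dl.
rewrite (@near_eq_derive _ _ _ _ (cst (1 : R))); last exact: near_neq0 y0 dot_homog_ext.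
rewrite derive_cst [dot ('D_v ell y) _]dotC => /esym/eqP.
by rewrite -mulr2n mulrn_eq0 => /eqP.
Qed.

(** Differentiate the orthogonality [<ell, D_w ell> = 0] along [v]. *)
Lemma dot_homog_ext_derive2 v w (y : 'rV[R]_n.+1) : y != 0 ->
  dot (ell y) ('D_v ('D_w ell) y) = - dot ('D_v ell y) ('D_w ell y).
Proof.
move=> y0; have [_] := derive_dot v (homog_ext_diff y0) (homog_ext_diff2 w y0).
rewrite (@near_eq_derive _ _ _ _ (cst 0)); last first.
  by apply: near_neq0 y0 _ => z; exact: dot_homog_ext_derive.
by rewrite derive_cst => /esym/eqP; rewrite addrC addr_eq0 => /eqP.
Qed.

End SphericalMap.

(** * Laplacian and energy of a spherical harmonic map *)

Lemma derive_inv_enorm_exp (R : realType) (N q : nat) (y v : 'rV[R]_N) : y != 0 ->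
  differentiable (fun z : 'rV[R]_N => (enorm z)^-1 ^+ q) y /\
  'D_v (fun z : 'rV[R]_N => (enorm z)^-1 ^+ q) y =
    - q%:R * (enorm y)^-1 ^+ q.+2 * dot y v.
Proof.
move=> y0; have [dn Dn] := derive_enorm v y0.
have n0 : enorm y != 0 by rewrite gt_eqF // enorm_gt0.
have [de De] : differentiable (fun z : 'rV[R]_N => (enorm z)^-1) y /\
    'D_v (fun z : 'rV[R]_N => (enorm z)^-1) y = - (enorm y)^-1 ^+ 3 * dot y v.
  split; first exact: (@differentiableV _ _ (@enorm R N)).
  rewrite (@deriveV _ _ (@enorm R N)) //; last exact: diff_derivable.
  by rewrite Dn /GRing.scale /=; field.
elim: q => [|q [dq Dq]].
  have -> : (fun z : 'rV[R]_N => (enorm z)^-1 ^+ 0) = cst 1 by [].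
  by rewrite derive_cst oppr0 !mul0r; split => //; exact: ex_diff.
have -> : (fun z : 'rV[R]_N => (enorm z)^-1 ^+ q.+1) =
    (fun z => (enorm z)^-1 * (enorm z)^-1 ^+ q).
  by apply/funext => z; rewrite exprS.
have [dm Dm] := derive_mul v de dq; split=> //.
by rewrite Dm De Dq -natr1 !exprS; ring.
Qed.

Section SphericalMapLaplacian.
Variables (R : realType) (n m k : nat) (L : 'rV[R]_n.+1 -> 'rV[R]_m.+1).
Hypothesis L_sphere : forall x, sphere x -> sphere (L x).
Hypothesis L_harm : forall j, spherical_harmonic k (fun x => L x 0 j).
Local Notation ell := (homog_ext L).

(** Off the origin each component is [|y|^-k P].  On the unit sphere, with
    [\sum_a x_a P_a = k P] and [\sum_a P_aa = 0], the terms of the product rule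
    add up to [k (k + 2) - k (n + 1) - 2 k^2 = - k (n + k - 1)] times [P]. *)
Lemma homog_ext_laplacian (x : 'rV[R]_n.+1) : sphere x ->
  \sum_a partial2 ell x a a = - (k%:R * (n%:R + k%:R - 1)) *: ell x.
Proof.
move=> x1; have x0 := sphere_neq0 x1; apply/rowP => j.
have [P Pharm ellE] := homog_ext_entry L_harm j.
have e1 : (enorm x)^-1 = 1 by rewrite x1 invr1.
pose Pf := mpoly_fun P; pose Pa a := mpoly_fun (mpoly.mderiv a P).
pose Paa a := mpoly_fun (mpoly.mderiv a (mpoly.mderiv a P)).
have [dP DP] : (forall y, differentiable Pf y) /\
    (forall a y, 'D_(delta_mx 0 a) Pf y = Pa a y).
  by split=> *; [exact: (derive_mpoly_fun P _).1|exact: (derive_mpoly_fun P _).2].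
have [dPa DPa] : (forall a y, differentiable (Pa a) y) /\
    (forall a y, 'D_(delta_mx 0 a) (Pa a) y = Paa a y).
  by split=> *; [exact: (derive_mpoly_fun _ _).1|exact: (derive_mpoly_fun _ _).2].
have D1 v (y : 'rV[R]_n.+1) : y != 0 -> 'D_v ell y 0 j =
    - k%:R * (enorm y)^-1 ^+ k.+2 * dot y v * Pf y + (enorm y)^-1 ^+ k * 'D_v Pf y.
  move=> y0; rewrite derive_entry; last exact: (homog_ext_diff L_harm).
  rewrite (eq_neq0_derive v ellE y0).
  have [dk Dk] := derive_inv_enorm_exp k v y0.
  by rewrite (derive_mul v dk (dP y)).2 Dk.
have euler : \sum_a x 0 a * Pa a x = k%:R * Pf x.
  have : 'D_x ell x 0 j = 0.
    rewrite deriveEjacobian; last exact: (homog_ext_diff L_harm).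
    by rewrite (homog_ext_euler L_harm) // mxE.
  rewrite D1 // e1 !expr1n dot_sphere // !mulr1 mul1r derive_comb // => /eqP.
  rewrite mulNr addrC subr_eq0 => /eqP <-; apply: eq_bigr => a _.
  by rewrite DP.
have lap : \sum_a Paa a x = 0.
  have := congr1 (fun Q => mpoly_fun Q x) Pharm.
  by rewrite /mpoly_fun mpoly.meval0 raddf_sum.
have D2 a : partial2 ell x a a 0 j =
    - k%:R * (- (k%:R + 2) * (x 0 a * x 0 a) * Pf x + (Pf x + x 0 a * Pa a x))
    + (- k%:R * (x 0 a * Pa a x) + Paa a x).
  rewrite /partial2 derive_entry; last exact: (homog_ext_diff2 L_harm).
  rewrite (@eq_neq0_derive _ _ _ _ ((fun y => - k%:R * ((enorm y)^-1 ^+ k.+2 * (y 0 a * Pf y)))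
    + (fun y => (enorm y)^-1 ^+ k * Pa a y))) //; last first.
    by move=> z z0; rewrite D1 // dot_delta DP !fctE !mulrA.
  have di : differentiable (@id 'rV[R]_n.+1) x by exact: ex_diff.
  have Dx : 'D_(delta_mx 0 a) (fun y : 'rV[R]_n.+1 => y 0 a) x = 1.
    by rewrite -(derive_entry _ a di) derive_id mxE !eqxx.
  have [dk Dk] := derive_inv_enorm_exp k (delta_mx 0 a) x0.
  have [dk2 Dk2] := derive_inv_enorm_exp k.+2 (delta_mx 0 a) x0.
  have [dyP DyP] := derive_mul (delta_mx 0 a) (differentiable_entry a di) (dP x).
  have [dF DF] := derive_mul (delta_mx 0 a) dk2 dyP.
  have [dG DG] := derive_mul (delta_mx 0 a) dk (dPa a x).
  have dc : differentiable (@cst 'rV[R]_n.+1 R (- k%:R)) x by exact: ex_diff.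
  have [dcF DcF] := derive_mul (delta_mx 0 a) dc dF.
  rewrite deriveD; [|exact: diff_derivable|exact: diff_derivable].
  rewrite DcF DF DG DyP Dk Dk2 derive_cst Dx DP DPa e1 !expr1n dot_delta /cst.
  by rewrite -addn2 natrD; ring.
rewrite summxE mxE; under eq_bigr => a _ do rewrite D2.
rewrite big_split -mulr_sumr big_split -mulr_suml -mulr_sumr /= -dotE dot_sphere //.
rewrite !big_split /= -mulr_sumr euler lap sumr_const card_ord ellE // e1 expr1n -/Pf.
by rewrite -mulr_natl -natr1; ring.
Qed.

(** Pair the Laplacian with [ell]: since [|ell| = 1], the result is minus the sum
    of the [|D_a ell|^2]. *)
Lemma homog_ext_energy (x : 'rV[R]_n.+1) : sphere x ->
  \tr ('J ell x *m ('J ell x)^T) = k%:R * (n%:R + k%:R - 1).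
Proof.
move=> x1; have x0 := sphere_neq0 x1.
have dl : differentiable ell x by exact: (homog_ext_diff L_harm).
have : dot (ell x) (\sum_a partial2 ell x a a) = - (k%:R * (n%:R + k%:R - 1)).
  by rewrite homog_ext_laplacian // dotZr (dot_homog_ext L_sphere) // mulr1.
rewrite /dot linear_sum mulmx_sumr summxE => /eqP; rewrite -eqr_oppLR => /eqP <-.
rewrite /mxtrace -sumrN; apply: eq_bigr => a _.
rewrite -/(dot _ _) /partial2 (dot_homog_ext_derive2 L_sphere L_harm) // opprK.
rewrite mxE dotE; apply: eq_bigr => b _.
by rewrite [_^T _ _]mxE !jacobianE.
Qed.

End SphericalMapLaplacian.

(** * The Gram matrix of the differential *)

(** An eigenvector [v] for [a != 0] is automatically tangent to the sphere,
    because [a <x, v> = <x, v A A^T> = <x A, v A> = 0]; and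
    [a |v|^2 = |v A|^2] shows [a > 0]. *)
Lemma singular_value_eigen (R : realType) (n m : nat) (L : 'rV[R]_n.+1 -> 'rV[R]_m.+1)
    (x : 'rV[R]_n.+1) (a : R) :
  x *m sphere_diff L x = 0 -> a != 0 ->
  eigenvalue (sphere_diff L x *m (sphere_diff L x)^T) a ->
  0 < a /\ singular_value L x (Num.sqrt a).
Proof.
set A := sphere_diff L x; move=> xA a0 /eigenvalueP[v vM v0].
have a_gt0 : 0 < a.
  have : 0 <= a * dot v v.
    rewrite -dotZl -vM /dot !mulmxA -(mulmxA _ A^T) -trmx_mul; exact: dot_ge0.
  by rewrite pmulr_lge0 ?lt0r ?a0 // dot_eq0 v0 dot_ge0.
split=> //; split; first exact: sqrtr_ge0.
exists v; split=> //; last by rewrite -/A sqr_sqrtr ?ltW.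
apply/eqP; rewrite -(mulrI_eq0 _ (mulfI a0)) -dotZr -vM.
by rewrite /dot !trmx_mul trmxK !mulmxA xA !mul0mx mxE.
Qed.

(** The equality of the non-zero singular values says that the Gram matrix [M] has a
    single non-zero eigenvalue [a], and there is one because [M] has positive
    trace.  Then [M / a] is idempotent of the rank [p] of the differential, so
    [a p] is the trace of [M], that is [k (n + k - 1)]. *)
Lemma LOMSE_gram (R : realType) (n m p k : nat) (L : 'rV[R]_n.+1 -> 'rV[R]_m.+1)
    (x : 'rV[R]_n.+1) :
  LOMSE_of_type p k L -> sphere x ->
  let mu := k%:R * (n%:R + k%:R - 1) / p%:R in
  0 < mu /\ exists Q : 'M[R]_n.+1, [/\ Q^T = Q, Q *m Q = Q, \tr Q = p%:R,
    x *m Q = 0 & 'J (homog_ext L) x *m ('J (homog_ext L) x)^T = mu *: Q].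
Proof.
move=> [[[theta [[Lsph _] _ _] _] sv] rk k2 Lharm] x1 mu.
have x0 := sphere_neq0 x1.
have xA : x *m sphere_diff L x = 0 := homog_ext_euler Lharm x0.
pose A := sphere_diff L x; pose M := A *m A^T.
have MT : M^T = M by rewrite trmx_mul trmxK.
have trM : \tr M = k%:R * (n%:R + k%:R - 1) := homog_ext_energy Lsph Lharm x1.
have trM_gt0 : 0 < \tr M.
  have k1 : 1 < k%:R :> R by rewrite ltr1n.
  rewrite trM mulr_gt0 //; first exact: lt_trans k1.
  by rewrite -addrA ltr_wpDl // subr_gt0.
have M0 : M != 0 by apply: contraTneq trM_gt0 => ->; rewrite mxtrace0 ltxx.
have [a [ea a0 MM]] : exists a, [/\ eigenvalue M a, a != 0 & M *m M = a *: M].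
  apply: sym_single_eigenvalue => // a b ea eb a0 b0.
  have [ap sa] := singular_value_eigen xA a0 ea.
  have [bp sb] := singular_value_eigen xA b0 eb.
  have : Num.sqrt a = Num.sqrt b by apply: (sv x) => //; rewrite gt_eqF // sqrtr_gt0.
  by move=> /(congr1 (fun s => s ^+ 2)); rewrite !sqr_sqrtr ?ltW.
have [a_gt0 _] := singular_value_eigen xA a0 ea.
(* [v *m M = 0] implies [v *m A = 0], so [M] has the rank of [A]. *)
have rkM : \rank M = p.
  rewrite -(rk x x1); apply/eqP; rewrite eqn_leq mxrankM_maxl /=.
  have kerMA : (kermx M <= kermx A)%MS.
    by apply/sub_kermxP; apply: mulmx_trl_eq0; exact: mulmx_ker.
  by have := mxrankS kerMA; rewrite !mxrank_ker leq_sub2lE // rank_leq_row.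
pose Q := a^-1 *: M.
have QQ : Q *m Q = Q.
  by rewrite /Q -scalemxAl -scalemxAr MM !scalerA -mulrA mulVf // mulr1.
have MQ : M = a *: Q by rewrite scalerA divff // scale1r.
have trQ : \tr Q = p%:R.
  by rewrite mxtrace_idem // mxrank_scale_nz ?invr_eq0 // rkM.
have muE : a * p%:R = k%:R * (n%:R + k%:R - 1).
  by rewrite -trM [X in _ = \tr X]MQ mxtraceZ trQ.
have p0 : p%:R != 0 :> R.
  by apply: contraTneq trM_gt0 => p0; rewrite trM -muE p0 mulr0 ltxx.
have mua : mu = a by rewrite /mu -muE mulfK.
split; first by rewrite mua.
exists Q; split=> //; last by rewrite mua -MQ.
  by rewrite /Q linearZ /= MT.
by rewrite /Q -scalemxAr mulmxA xA mul0mx scaler0.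
Qed.

(** * Submanifolds that are graphs *)

Lemma normal_proj_trace (R : realType) (d N q : nat) (A : 'M[R]_(q, N)) (g : 'M[R]_d)
    (II : 'I_d -> 'I_d -> 'rV[R]_N) :
  metric_trace g (fun i j => normal_proj A (II i j)) = normal_proj A (metric_trace g II).
Proof.
rewrite /metric_trace /normal_proj mulmx_suml; apply: eq_bigr => i _.
by rewrite mulmx_suml; apply: eq_bigr => j _; rewrite scalemxAl.
Qed.

(** A parametrization [phi] of a piece of the graph of [G] is determined by its
    first component [y].  With row vectors the tangent space is spanned by the
    rows of [row_mx 1%:M JG], and [Y] is the change of coordinates.  The
    dimension [d] is kept free: it is [N] for a piece of the graph, and [N - 1]
    for the part of the graph over a sphere. *)
Section Graph.
Variables (R : realType) (d N M : nat).
Variables (G : 'rV[R]_N -> 'rV[R]_M) (U : set 'rV[R]_d) (phi : 'rV[R]_d -> 'rV[R]_(N + M)).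
Variable u : 'rV[R]_d.
Let y (w : 'rV[R]_d) : 'rV[R]_N := lsubmx (phi w).
Hypothesis G_smooth : smooth_on_open [set z | z != 0] G.
Hypothesis U_open : open U.
Hypothesis phi_smooth : smooth_on_open U phi.
Hypothesis Uu : U u.
Hypothesis yu0 : y u != 0.
Hypothesis phi_graph : \forall w \near u, phi w = row_mx (y w) (G (y w)).

Let Y := 'J y u.
Let JG := 'J G (y u).

Let dphi w : U w -> differentiable phi w.
Proof. exact: (phi_smooth [::]). Qed.

Let dDphi v w : U w -> differentiable ('D_v phi) w.
Proof. exact: (phi_smooth [:: v]). Qed.

Let nearU : \forall w \near u, U w.
Proof. exact: open_nbhs_nbhs. Qed.

Let near_y0 : \forall w \near u, y w != 0.
Proof.
have cy : {for u, continuous y}.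
  by apply: differentiable_continuous; exact: (derive_lsubmx 0 (dphi Uu)).1.
apply: (cy [set z | z != 0]); apply: open_nbhs_nbhs; split => //; exact: open_neq0.
Qed.

Let y_diff : \forall w \near u, differentiable y w /\ differentiable G (y w).
Proof.
near=> w; split.
  by apply: (derive_lsubmx 0 (dphi _)).1; near: w.
by apply: (G_smooth [::]); near: w.
Unshelve. all: by end_near. Qed.

Let dDy v : differentiable ('D_v y) u.
Proof.
apply: (near_eq_diff (h := fun w => lsubmx ('D_v phi w))); last first.
  exact: (derive_lsubmx 0 (dDphi v Uu)).1.
near=> w; apply: (derive_lsubmx v (dphi _)).2; near: w; exact: nearU.
Unshelve. all: by end_near. Qed.

Lemma graph_jacobian : 'J phi u = Y *m row_mx 1%:M JG.
Proof.
have [dy dG] := nbhs_singleton y_diff.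
apply/row_matrixP => i; rewrite row_mul !rowE -!deriveEjacobian //; last exact: dphi.
rewrite -[LHS]hsubmxK mul_mx_row mulmx1; congr row_mx.
  by rewrite -(derive_lsubmx _ (dphi Uu)).2.
rewrite -(derive_rsubmx _ (dphi Uu)).2 -deriveEjacobian // -derive_chain //.
apply: near_eq_derive; near=> w.
have -> : phi w = row_mx (y w) (G (y w)) by near: w.
by rewrite row_mxKr.
Unshelve. all: by end_near. Qed.

Lemma graph_partial2 i j : partial2 phi u i j =
  row_mx (partial2 y u i j)
    (\sum_a \sum_b (Y i a * Y j b) *: partial2 G (y u) a b + partial2 y u i j *m JG).
Proof.
rewrite -[LHS]hsubmxK; congr row_mx.
  rewrite /partial2 -(derive_lsubmx _ (dDphi _ Uu)).2; apply/esym/near_eq_derive.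
  near=> w; apply: (derive_lsubmx _ (dphi _)).2; near: w; exact: nearU.
rewrite -partial2_comp //; last by move=> b; exact: (G_smooth [:: _]).
rewrite /partial2 -(derive_rsubmx _ (dDphi _ Uu)).2; apply: near_eq_derive.
have := near_join phi_graph => phi_graph2.
near=> w; rewrite -(derive_rsubmx _ (dphi _)).2; last by near: w; exact: nearU.
apply: near_eq_derive.
have : \near w, phi w = row_mx (y w) (G (y w)) by near: w.
by apply: filterS => z ->; rewrite row_mxKr.
Unshelve. all: by end_near. Qed.

Let g := induced_metric phi u.
Let P := Y^T *m invmx g *m Y.

Lemma graph_metric : g = Y *m (1%:M + JG *m JG^T) *m Y^T.
Proof.
rewrite /g /induced_metric graph_jacobian trmx_mul tr_row_mx trmx1.
by rewrite mulmxA -(mulmxA Y) mul_row_col mulmx1.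
Qed.

(** The second derivatives of [y] contribute a combination of the rows of
    [row_mx 1%:M JG], which is tangent to the graph of [G]. *)
Lemma graph_trace : metric_trace g (partial2 phi u) =
  row_mx (metric_trace g (partial2 y u))
    (hess_contr P G (y u) + metric_trace g (partial2 y u) *m JG).
Proof.
have E : metric_trace g (fun i j => \sum_a \sum_b (Y i a * Y j b) *: partial2 G (y u) a b)
    = hess_contr P G (y u).
  rewrite /metric_trace /hess_contr.
  under eq_bigr => i _ do under eq_bigr => j _ do rewrite scaler_sumr.
  under eq_bigr => i _ do rewrite exchange_big /=.
  rewrite exchange_big; apply: eq_bigr => a _ /=.
  under eq_bigr => i _ do under eq_bigr => j _ do rewrite scaler_sumr.
  under eq_bigr => i _ do rewrite exchange_big /=.
  rewrite exchange_big; apply: eq_bigr => b _ /=.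
  rewrite /P -mulmxA mxE scaler_suml; apply: eq_bigr => i _ /=.
  rewrite [_^T a i]mxE [(invmx g *m Y) i b]mxE mulr_sumr scaler_suml; apply: eq_bigr => j _ /=.
  by rewrite scalerA; congr (_ *: _); ring.
rewrite -[LHS]hsubmxK; congr row_mx.
  rewrite /metric_trace !linear_sum; apply: eq_bigr => i _.
  rewrite !linear_sum; apply: eq_bigr => j _.
  by rewrite linearZ /= graph_partial2 row_mxKl.
rewrite -E /metric_trace mulmx_suml -big_split linear_sum; apply: eq_bigr => i _ /=.
rewrite mulmx_suml -big_split linear_sum; apply: eq_bigr => j _ /=.
by rewrite linearZ /= graph_partial2 row_mxKr scalerDr scalemxAl.
Qed.

End Graph.

Lemma sub_graph (R : realType) (N M : nat) (z : 'rV[R]_N) (w : 'rV[R]_M) (JG : 'M[R]_(N, M)) :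
  (row_mx z w <= row_mx 1%:M JG)%MS = (w == z *m JG).
Proof.
apply/submxP/eqP => [[D]|->]; last by exists z; rewrite mul_mx_row mulmx1.
by rewrite mul_mx_row mulmx1 => /eq_row_mx[-> ->].
Qed.

(** When [y] has full dimension, [Y] is invertible: the contracted form
    [Y^T g^-1 Y] is the inverse of the metric of the graph in the coordinate
    [y], and the tangent space is that of the graph.  So the equation between normal
    components says that a vector [(z, w)] is tangent, that is
    [w = z *m JG]; the horizontal parts cancel. *)
Lemma graph_mean_curvature (R : realType) (N M : nat) (G : 'rV[R]_N -> 'rV[R]_M)
    (U : set 'rV[R]_N) (phi : 'rV[R]_N -> 'rV[R]_(N + M)) (u : 'rV[R]_N) (C : R) :
  smooth_on_open [set z | z != 0] G -> open U -> smooth_on_open U phi -> U u ->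
  lsubmx (phi u) != 0 ->
  (\forall w \near u, phi w = row_mx (lsubmx (phi w)) (G (lsubmx (phi w)))) ->
  row_free ('J phi u) ->
  let y := lsubmx (phi u) in let JG := 'J G y in
  mean_curvature phi u = C *: normal_proj ('J phi u) (phi u) <->
  hess_contr (invmx (1%:M + JG *m JG^T)) G y = C *: (G y - y *m JG).
Proof.
move=> Gs oU phis Uu yu0 graph Jfree y JG.
have JE := graph_jacobian Gs oU phis Uu yu0 graph.
have gE := graph_metric Gs oU phis Uu yu0 graph.
have tE := graph_trace Gs oU phis Uu yu0 graph.
have gU := gram_unit Jfree; have phiu := nbhs_singleton graph.
rewrite -/y -/JG in JE gE tE phiu; rewrite -/(induced_metric phi u) in gU.
move: JE gE tE; set Y := 'J (fun w => lsubmx (phi w)) u.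
set z := metric_trace _ (partial2 (fun w => lsubmx (phi w)) u).
set A := 1%:M + _ => JE gE tE.
have Yu : Y \in unitmx.
  rewrite -row_free_unit -row_leq_rank -{1}(eqP Jfree) JE; exact: mxrankM_maxl.
have YTu : Y^T \in unitmx by rewrite unitmx_tr.
have PA : Y^T *m invmx (induced_metric phi u) *m Y *m A = 1%:M.
  rewrite -[LHS](mulmxK YTu) -!mulmxA (mulmxA A) (mulmxA Y (A *m _)) (mulmxA Y A) -gE.
  by rewrite (mulmxA (invmx _)) mulVmx // mul1mx mulmxV.
have [_ AU] := mulmx1_unit PA.
have PE : Y^T *m invmx (induced_metric phi u) *m Y = invmx A.
  by rewrite -[LHS](mulmxK AU) PA mul1mx.
rewrite PE in tE.
rewrite /mean_curvature [X in metric_trace _ X](_ : _ =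
  fun i j => normal_proj ('J phi u) (partial2 phi u i j)) // normal_proj_trace tE.
rewrite (rwP eqP) -subr_eq0 /normal_proj scalemxAl -mulmxBl -/(normal_proj _ _).
rewrite normal_projP JE (eqmxMfull _ _); last by rewrite row_full_unit.
rewrite phiu scale_row_mx opp_row_mx add_row_mx sub_graph mulmxBl -scalemxAl.
rewrite (rwP eqP) -subr_eq0 -[in X in _ <-> X]subr_eq0.
rewrite scalerBr; suff -> : forall a b c e : 'rV[R]_M, a + b - c - (b - e) = a - (c - e) by [].
move=> a b c e; rewrite opprB addrAC -!addrA; congr (_ + _).
by rewrite addrCA opprB; congr (_ + _); rewrite addrA subrr add0r.
Qed.

(** The part of the graph of [G] over a sphere centred at 0, for a [G] that is
    radially constant at [y].  The tangent space is the image of the orthogonal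
    complement of [y], and [P] is the inverse of [A = 1 + JG JG^T] on that
    complement, extended by 0: [A *m P] and the projection off [y] agree when
    multiplied on the left by the rows of [Y] and by [y], which together form a
    basis.  A vanishing mean curvature in the ambient sphere leaves only a
    multiple [b] of the position vector. *)
Lemma graph_minimal (R : realType) (n M : nat) (G : 'rV[R]_n.+1 -> 'rV[R]_M)
    (U : set 'rV[R]_n) (phi : 'rV[R]_n -> 'rV[R]_(n.+1 + M)) (u : 'rV[R]_n) :
  smooth_on_open [set z | z != 0] G -> open U -> smooth_on_open U phi -> U u ->
  lsubmx (phi u) != 0 ->
  (\forall w \near u, phi w = row_mx (lsubmx (phi w)) (G (lsubmx (phi w)))) ->
  row_free ('J phi u) ->
  let y := lsubmx (phi u) in let JG := 'J G y in
  (\forall w \near u, dot (lsubmx (phi w)) (lsubmx (phi w)) = dot y y) ->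
  y *m JG = 0 -> sphere_mean_curvature phi u = 0 ->
  exists (P : 'M[R]_n.+1) (b : R),
    (1%:M + JG *m JG^T) *m P = 1%:M - (dot y y)^-1 *: (y^T *m y) /\
    hess_contr P G y = b *: G y.
Proof.
move=> Gs oU phis Uu yu0 graph Jfree y JG sph yJG minim.
have JE := graph_jacobian Gs oU phis Uu yu0 graph.
have gE := graph_metric Gs oU phis Uu yu0 graph.
have tE := graph_trace Gs oU phis Uu yu0 graph.
have gU := gram_unit Jfree; have phiu := nbhs_singleton graph.
have yY0 : y *m ('J (fun w => lsubmx (phi w)) u)^T = 0.
  have [dy _] := derive_lsubmx 0 (phis [::] u Uu).
  apply/rowP => i; rewrite mxE [RHS]mxE.
  have [_] := derive_dot (delta_mx 0 i) dy dy.
  rewrite (@near_eq_derive _ _ _ _ (cst (dot y y))) // derive_cst.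
  rewrite [X in _ = X + _]dotC -mulr2n => /esym/eqP; rewrite mulrn_eq0 /= => /eqP dot0.
  rewrite -[RHS]dot0 dotE; apply: eq_bigr => j _.
  by rewrite [_^T j i]mxE jacobianE.
rewrite -/y -/JG in JE gE tE phiu; rewrite -/(induced_metric phi u) in gU.
move: JE gE tE yY0; set Y := 'J (fun w => lsubmx (phi w)) u.
set z := metric_trace _ (partial2 (fun w => lsubmx (phi w)) u).
set A := 1%:M + _ => JE gE tE yY0.
set P := Y^T *m invmx (induced_metric phi u) *m Y in tE.
have Yfree : row_free Y.
  rewrite -row_leq_rank -{1}(eqP Jfree) JE; exact: mxrankM_maxl.
have dyy : dot y y != 0 by rewrite dot_eq0.
have yyT : y *m y^T = (dot y y)%:M by rewrite [LHS]mx11_scalar.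
have Yy0 : Y *m y^T = 0 by rewrite -[LHS]trmxK trmx_mul trmxK yY0 trmx0.
have YAP : Y *m (A *m P) = Y by rewrite /P !mulmxA -gE mulmxV // mul1mx.
have yAP : y *m (A *m P) = 0.
  have yA : y *m A = y by rewrite /A mulmxDr mulmx1 mulmxA yJG mul0mx addr0.
  by rewrite mulmxA yA /P !mulmxA yY0 !mul0mx.
pose Pi := 1%:M - (dot y y)^-1 *: (y^T *m y).
have YPi : Y *m Pi = Y by rewrite mulmxBr mulmx1 -scalemxAr mulmxA Yy0 mul0mx scaler0 subr0.
have yPi : y *m Pi = 0.
  rewrite mulmxBr mulmx1 -scalemxAr mulmxA yyT mul_scalar_mx scalerA mulVf //.
  by rewrite scale1r subrr.
(* The rows of [Y] are a basis of the complement of [y]. *)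
have frame_free : row_free (col_mx Y y).
  rewrite -kermx_eq0; apply/rowV0P => v /sub_kermxP.
  rewrite -[v]hsubmxK mul_row_col => H.
  have v2 : rsubmx v = 0.
    have := congr1 (fun X => X *m y^T) H.
    rewrite mulmxDl mul0mx -mulmxA Yy0 mulmx0 add0r -mulmxA yyT mul_mx_scalar.
    by move=> /eqP; rewrite scaler_eq0 (negPf dyy) => /eqP.
  move: H; rewrite v2 mul0mx addr0 => H.
  have v1 : lsubmx v = 0 by apply: (row_free_inj Yfree); rewrite mul0mx.
  by rewrite v1 row_mx0.
have /row_fullP[B BE] : row_full (col_mx Y y).
  by rewrite /row_full (eqP frame_free) addn1.
exists P; move: minim; rewrite /sphere_mean_curvature.
rewrite [X in metric_trace _ X](_ : _ =
  fun i j => normal_proj (col_mx ('J phi u) (phi u)) (partial2 phi u i j)) //.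
rewrite normal_proj_trace tE => /eqP; rewrite normal_projP => /submxP[D].
rewrite -[D]hsubmxK mul_row_col JE phiu mulmxA mul_mx_row mulmx1.
rewrite [rsubmx D]mx11_scalar mul_scalar_mx scale_row_mx add_row_mx.
move=> /eq_row_mx[-> hE]; exists (rsubmx D 0 0); split.
  apply/eqP; rewrite -/Pi -subr_eq0 -[A *m P - Pi]mul1mx -BE -mulmxA mul_col_mx.
  by rewrite !(mulmxBr _ (A *m P)) YAP yAP YPi yPi !subrr col_mx0 mulmx0.
move: hE; rewrite mulmxDl -scalemxAl yJG scaler0 addr0 addrC => /addrI.
by [].
Qed.

(** * Graphs with a radial profile *)

Section RadialProfile.
Variables (R : realType) (n m k : nat) (L : 'rV[R]_n.+1 -> 'rV[R]_m.+1) (f : R -> R).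
Hypothesis L_sphere : forall x, sphere x -> sphere (L x).
Hypothesis L_harm : forall j, spherical_harmonic k (fun x => L x 0 j).
Hypothesis f_smooth : forall (i : nat) (r : R), 0 < r -> differentiable (f^`(i)%classic) r.
Local Notation ell := (homog_ext L).

Definition radial_graph (y : 'rV[R]_n.+1) : 'rV[R]_m.+1 := f (enorm y) *: ell y.

Lemma radial_graph_alg j : radial_alg f (fun y => radial_graph y 0 j).
Proof.
apply: (RadExt (h := fun y => f^`(0)%classic (enorm y) * ell y 0 j)).
  by move=> y _; rewrite mxE.
by apply: RadMul; [exact: RadProfile|exact: (homog_ext_alg L_harm)].
Qed.

Lemma radial_graph_smooth : smooth_on_open [set y | y != 0] radial_graph.
Proof. exact: (smooth_radial_row f_smooth radial_graph_alg). Qed.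

Lemma derive_profile (i : nat) (y v : 'rV[R]_n.+1) : y != 0 ->
  differentiable (fun z => f^`(i)%classic (@enorm R n.+1 z)) y /\
  'D_v (fun z => f^`(i)%classic (@enorm R n.+1 z)) y =
    f^`(i.+1)%classic (enorm y) * ((enorm y)^-1 * dot y v).
Proof.
move=> y0; have [dn Dn] := derive_enorm v y0.
have dfi : differentiable (f^`(i)%classic) (enorm y) by apply: f_smooth; rewrite enorm_gt0.
have dc : differentiable (f^`(i)%classic \o @enorm R n.+1) y by exact: differentiable_comp.
split=> //; rewrite (deriveE v dc) (@diff_comp _ _ _ _ (@enorm R n.+1)) //=.
by rewrite -(deriveE _ dn) Dn diff1E // /GRing.scale /= mulrC.
Qed.

Lemma radial_graph_derive (y v : 'rV[R]_n.+1) : y != 0 ->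
  'D_v radial_graph y =
    (f^`()%classic (enorm y) * ((enorm y)^-1 * dot y v)) *: ell y
    + f (enorm y) *: 'D_v ell y.
Proof.
move=> y0; have [df Df] := derive_profile 0 v y0.
by rewrite (derive_scale v df (homog_ext_diff L_harm y0)).2 Df.
Qed.

#[local] Opaque homog_ext radial_graph.

Variables (r : R) (x : 'rV[R]_n.+1).
Hypothesis r_gt0 : 0 < r.
Hypothesis x1 : sphere x.

Let x0 : x != 0 := sphere_neq0 x1.
Let y0 : r *: x != 0.
Proof. by rewrite scaler_eq0 negb_or gt_eqF. Qed.
Let yr : enorm (r *: x) = r.
Proof. by rewrite enormZ ?ltW // x1 mulr1. Qed.
Let r0 : r != 0.
Proof. by rewrite gt_eqF. Qed.
Let ell_r : ell (r *: x) = ell x.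
Proof. exact: homog_extZ. Qed.

Let derive_ell_r v : 'D_v ell (r *: x) = r^-1 *: 'D_v ell x.
Proof. by rewrite (homog_ext_deriveZ L_harm v r_gt0 x0) scalerA mulVf // scale1r. Qed.

Lemma radial_graph_jacobian : 'J radial_graph (r *: x) =
  f^`()%classic r *: (x^T *m ell x) + (f r / r) *: 'J ell x.
Proof.
have dG := radial_graph_smooth [::] y0.
have dl := homog_ext_diff L_harm x0.
apply/row_matrixP => a; rewrite !rowE -deriveEjacobian // mulmxDr -!scalemxAr mulmxA.
rewrite -(deriveEjacobian _ dl) (radial_graph_derive _ y0) yr dotZl ell_r derive_ell_r.
rewrite scalerA (mulrA r^-1) mulVf // mul1r dot_delta; congr (_ + _).
rewrite -scalerA; congr (_ *: _).
by rewrite [_ *m x^T]mx11_scalar mul_scalar_mx -/(dot _ _) dotC dot_delta.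
Qed.

Let ell_J : ell x *m ('J ell x)^T = 0.
Proof.
have dl := homog_ext_diff L_harm x0.
apply/rowP => a; rewrite mxE [RHS]mxE.
rewrite -[RHS](dot_homog_ext_derive L_sphere L_harm (delta_mx 0 a) x0).
by rewrite dotE; apply: eq_bigr => b _; rewrite [_^T b a]mxE jacobianE.
Qed.

(** The mixed terms vanish because [ell] is orthogonal to its derivatives. *)
Lemma radial_graph_gram :
  'J radial_graph (r *: x) *m ('J radial_graph (r *: x))^T =
  f^`()%classic r ^+ 2 *: (x^T *m x)
  + (f r / r) ^+ 2 *: ('J ell x *m ('J ell x)^T).
Proof.
have ell1 : ell x *m (ell x)^T = 1%:M.
  by rewrite [LHS]mx11_scalar -/(dot _ _) (dot_homog_ext L_sphere).
have J_ell : 'J ell x *m (ell x)^T = 0 by rewrite -[LHS]trmxK trmx_mul trmxK ell_J trmx0.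
rewrite radial_graph_jacobian linearD /= !linearZ /= trmx_mul trmxK.
rewrite mulmxDl !mulmxDr -!scalemxAl -!scalemxAr !mulmxA.
rewrite -(mulmxA _ (ell x) (ell x)^T) ell1 mulmx1 -(mulmxA _ (ell x) (_^T)) ell_J.
by rewrite J_ell mulmx0 mul0mx !scaler0 addr0 add0r !scalerA -!expr2.
Qed.

Lemma radial_graph_euler :
  (r *: x) *m 'J radial_graph (r *: x) = (r * f^`()%classic r) *: ell x.
Proof.
rewrite radial_graph_jacobian mulmxDr -!scalemxAr -!scalemxAl (homog_ext_euler L_harm x0).
rewrite !scaler0 addr0 mulmxA [x *m x^T]mx11_scalar -/(dot _ _) dot_sphere //.
by rewrite mul1mx scalerA mulrC.
Qed.

Lemma hess_contr_ellZ (S : 'M[R]_n.+1) :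
  hess_contr S ell (r *: x) = r^-2 *: hess_contr S ell x.
Proof.
rewrite /hess_contr scaler_sumr; apply: eq_bigr => a _; rewrite scaler_sumr.
apply: eq_bigr => b _; rewrite /partial2 (homog_ext_derive2Z L_harm _ _ r_gt0 x0).
by rewrite !scalerA; congr (_ *: _); field.
Qed.

Lemma radial_graph_partial2 a b : partial2 radial_graph (r *: x) a b =
  (f^`(2)%classic r * (x 0 a * x 0 b)
    + f^`()%classic r / r * ((a == b)%:R - x 0 a * x 0 b)) *: ell x
  + (f^`()%classic r / r * x 0 b) *: 'D_(delta_mx 0 a) ell x
  + (f^`()%classic r / r * x 0 a) *: 'D_(delta_mx 0 b) ell x
  + f r *: partial2 ell (r *: x) a b.
Proof.
rewrite /partial2.
rewrite (@eq_neq0_derive _ _ _ _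
  ((fun y => (f^`(1)%classic (enorm y) * ((enorm y)^-1 ^+ 1 * y 0 b)) *: ell y)
  + (fun y => f^`(0)%classic (enorm y) *: 'D_(delta_mx 0 b) ell y))) //; last first.
  by move=> z z0; rewrite radial_graph_derive // dot_delta.
have di : differentiable (@id 'rV[R]_n.+1) (r *: x) by exact: ex_diff.
have Dx : 'D_(delta_mx 0 a) (fun y : 'rV[R]_n.+1 => y 0 b) (r *: x) = (a == b)%:R.
  by rewrite -(derive_entry _ b di) derive_id mxE eqxx eq_sym.
have [de De] := derive_inv_enorm_exp 1 (delta_mx 0 a) y0.
have [dey Dey] := derive_mul (delta_mx 0 a) de (differentiable_entry b di).
have [df1 Df1] := derive_profile 1 (delta_mx 0 a) y0.
have [df0 Df0] := derive_profile 0 (delta_mx 0 a) y0.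
have [dg Dg] := derive_mul (delta_mx 0 a) df1 dey.
have dl := homog_ext_diff L_harm y0.
have dl2 := homog_ext_diff2 L_harm (delta_mx 0 b) y0.
have [dA DA] := derive_scale (delta_mx 0 a) dg dl.
have [dB DB] := derive_scale (delta_mx 0 a) df0 dl2.
rewrite deriveD; [|exact: diff_derivable|exact: diff_derivable].
rewrite DA DB Dg Dey De Df1 Df0 Dx yr ell_r !derive_ell_r dot_delta !mxE !addrA.
congr (_ + _); rewrite !scalerA.
by congr (_ *: _ + _ *: _ + _ *: _); rewrite derive1n1; field.
Qed.

(** The mixed terms [D_a f(|y|) D_b ell] contract to multiples of [D_x ell = 0]
    because [x] is an eigenvector of [S]. *)
Lemma radial_graph_hess (S : 'M[R]_n.+1) (sigma : R) :
  S^T = S -> x *m S = sigma *: x ->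
  hess_contr S radial_graph (r *: x) =
    (f^`(2)%classic r * sigma + f^`()%classic r / r * (\tr S - sigma)) *: ell x
    + f r *: hess_contr S ell (r *: x).
Proof.
move=> ST xS.
have dl := homog_ext_diff L_harm x0.
have Sx : S *m x^T = sigma *: x^T by rewrite -{1}ST -trmx_mul xS linearZ.
have xSx : \sum_a \sum_b S a b * (x 0 a * x 0 b) = sigma.
  have : (x *m S *m x^T) 0 0 = sigma.
    by rewrite xS -scalemxAl mxE -/(dot x x) dot_sphere // mulr1.
  rewrite -mulmxA mxE => <-; apply: eq_bigr => a _; rewrite mxE mulr_sumr.
  by apply: eq_bigr => b _; rewrite [_^T b 0]mxE; ring.
have trS : \sum_a \sum_b S a b * (a == b)%:R = \tr S.
  apply: eq_bigr => a _; rewrite (bigD1 a) //= big1 ?addr0 ?eqxx ?mulr1 // => b ba.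
  by rewrite eq_sym (negPf ba) mulr0.
have D0 : \sum_a x 0 a *: 'D_(delta_mx 0 a) ell x = 0.
  by rewrite -derive_comb // deriveEjacobian // (homog_ext_euler L_harm).
have Z1 : \sum_a \sum_b S a b *: ((f^`()%classic r / r * x 0 b) *: 'D_(delta_mx 0 a) ell x) = 0.
  rewrite -[RHS](scaler0 _ (f^`()%classic r / r * sigma)) -[X in _ = _ *: X]D0 scaler_sumr.
  apply: eq_bigr => a _.
  have := congr1 (fun X : 'cV[R]_n.+1 => X a 0) Sx; rewrite mxE [RHS]mxE [x^T a 0]mxE => E.
  rewrite scalerA -(mulrA (_ / _)) -E mulr_sumr scaler_suml; apply: eq_bigr => b _.
  by rewrite scalerA [_^T b 0]mxE; congr (_ *: _); ring.
have Z2 : \sum_a \sum_b S a b *: ((f^`()%classic r / r * x 0 a) *: 'D_(delta_mx 0 b) ell x) = 0.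
  rewrite exchange_big /= -[RHS]Z1.
  apply: eq_bigr => a _; apply: eq_bigr => b _.
  have Sba : S b a = S a b by rewrite -{1}ST mxE.
  by rewrite Sba.
have -> : hess_contr S radial_graph (r *: x) =
    (\sum_a \sum_b S a b * (f^`(2)%classic r * (x 0 a * x 0 b)
      + f^`()%classic r / r * ((a == b)%:R - x 0 a * x 0 b))) *: ell x
    + \sum_a \sum_b S a b *: ((f^`()%classic r / r * x 0 b) *: 'D_(delta_mx 0 a) ell x)
    + \sum_a \sum_b S a b *: ((f^`()%classic r / r * x 0 a) *: 'D_(delta_mx 0 b) ell x)
    + f r *: hess_contr S ell (r *: x).
  rewrite scaler_suml /hess_contr scaler_sumr -!big_split; apply: eq_bigr => a _ /=.
  rewrite scaler_suml scaler_sumr -!big_split; apply: eq_bigr => b _ /=.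
  rewrite (radial_graph_partial2 a b).
  move: (partial2 ell _ a b) ('D_(delta_mx 0 a) ell x) ('D_(delta_mx 0 b) ell x).
  by move=> p Da Db; rewrite !scalerDr !scalerA [f r * _]mulrC.
rewrite [X in _ + X + _ + _ = _]Z1 [X in _ + _ + X + _ = _]Z2 !addr0.
congr (_ *: _ + _).
transitivity (\sum_a \sum_b (f^`(2)%classic r * (S a b * (x 0 a * x 0 b))
    + f^`()%classic r / r * (S a b * (a == b)%:R - S a b * (x 0 a * x 0 b)))).
  by apply: eq_bigr => a _; apply: eq_bigr => b _; ring.
rewrite -xSx -trS -sumrB !mulr_sumr -big_split; apply: eq_bigr => a _ /=.
by rewrite -sumrB !mulr_sumr -big_split.
Qed.

End RadialProfile.

(** * The curvature of the image of a Lawson-Osserman map *)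

(** The bridge between the polar description of the submanifolds and their
    description as graphs. *)
Lemma radial_graph_point (R : realType) (n m : nat) (L : 'rV[R]_n.+1 -> 'rV[R]_m.+1)
    (f : R -> R) (r : R) (x : 'rV[R]_n.+1) : 0 < r -> sphere x ->
  row_mx (r *: x) (f r *: L x) = row_mx (r *: x) (radial_graph L f (r *: x)).
Proof.
move=> r0 x1; congr row_mx; rewrite /radial_graph homog_extZ // homog_ext_sphere //.
by rewrite enormZ ?ltW // x1 mulr1.
Qed.

Section SphericalMapHessian.
Variables (R : realType) (n m k : nat) (L : 'rV[R]_n.+1 -> 'rV[R]_m.+1).
Hypothesis L_sphere : forall x, sphere x -> sphere (L x).
Hypothesis L_harm : forall j, spherical_harmonic k (fun x => L x 0 j).
Local Notation ell := (homog_ext L).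

Lemma hess_contr_radial (x : 'rV[R]_n.+1) : x != 0 -> hess_contr (x^T *m x) ell x = 0.
Proof.
move=> x0; rewrite -[RHS](homog_ext_euler2 L_harm x0).
apply: eq_bigr => a _; apply: eq_bigr => b _.
by rewrite mxE big_ord1 mxE.
Qed.

(** [<ell, D_a D_b ell> = - <D_a ell, D_b ell>]. *)
Lemma dot_hess_contr (S : 'M[R]_n.+1) (x : 'rV[R]_n.+1) : x != 0 ->
  dot (ell x) (hess_contr S ell x) = - \tr (S *m ('J ell x *m ('J ell x)^T)).
Proof.
move=> x0; have dl := homog_ext_diff L_harm x0.
rewrite /dot linear_sum mulmx_sumr summxE /mxtrace -sumrN; apply: eq_bigr => a _.
rewrite linear_sum mulmx_sumr summxE mxE -sumrN; apply: eq_bigr => b _.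
rewrite -/(dot _ _) dotZr (dot_homog_ext_derive2 L_sphere L_harm) // mulrN; congr (- (_ * _)).
rewrite mxE dotE; apply: eq_bigr => j _.
rewrite [_^T j a]mxE (jacobianE _ _ dl) (jacobianE _ _ dl).
exact: mulrC.
Qed.

End SphericalMapHessian.

Lemma LO_sphere_graph (R : realType) (n m : nat) (L : 'rV[R]_n.+1 -> 'rV[R]_m.+1)
    (theta : R) (z : 'rV[R]_(n.+1 + m.+1)) : 0 < cos theta -> LO_sphere L theta z ->
  z = row_mx (lsubmx z) (radial_graph L (cst (sin theta)) (lsubmx z)) /\
  dot (lsubmx z) (lsubmx z) = cos theta ^+ 2.
Proof.
move=> c0 [x x1 <-]; rewrite row_mxKl; split.
  exact: (@radial_graph_point _ _ _ L (cst (sin theta))).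
by rewrite dotZl dotZr dot_sphere // mulr1.
Qed.

(** Let [c = cos theta], [s = sin theta] and [nu = (s / c)^2 mu].  At the point
    of the Lawson-Osserman sphere above [x], minimality gives
    that [hess_contr P ell] is parallel to [ell] for
    [P = 1 - x^T x - nu / (1 + nu) Q].  The first two terms contribute the
    Laplacian and 0, and [nu != 0], so [hess_contr Q ell] is parallel to [ell];
    its component along [ell] is [- \tr (Q M) = - p mu]. *)
Lemma LOMSE_range_hess (R : realType) (n m p k : nat) (L : 'rV[R]_n.+1 -> 'rV[R]_m.+1)
    (x : 'rV[R]_n.+1) (mu : R) (Q : 'M[R]_n.+1) :
  LOMSE_of_type p k L -> sphere x -> 0 < mu ->
  Q^T = Q -> Q *m Q = Q -> \tr Q = p%:R -> x *m Q = 0 ->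
  'J (homog_ext L) x *m ('J (homog_ext L) x)^T = mu *: Q ->
  hess_contr Q (homog_ext L) x = - (p%:R * mu) *: homog_ext L x.
Proof.
move=> [[[theta [[Lsph _] th [_ sub minim]] _] _] rk k2 Lharm] x1 mu0 QT QQ trQ xQ ME.
have x0 := sphere_neq0 x1; have xx := dot_sphere x1.
have c0 : 0 < cos theta.
  apply: cos_gt0_pihalf; case/andP: th => t0 ->; rewrite (lt_trans _ t0) //.
  by rewrite oppr_lt0 divr_gt0 ?pi_gt0.
have s0 : 0 < sin theta.
  apply: sin_gt0_pi; case/andP: th => t0 t1; rewrite t0 (lt_trans t1) //.
  by rewrite ltr_pdivrMr // ltr_pMr ?pi_gt0 // ltr1n.
have Sq : LO_sphere L theta (row_mx (cos theta *: x) (sin theta *: L x)) by exists x.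
have [U [phi [u [param Uu phiu]]]] := sub _ Sq.
have minu := minim _ _ param _ Uu.
have [oU phis Jfree [V _ imV] _] := param.
have US w : U w -> LO_sphere L theta (phi w).
  by move=> Uw; have [] : (LO_sphere L theta `&` V) (phi w) by rewrite -imV; exists w.
have nearU : \forall w \near u, U w by exact: open_nbhs_nbhs.
have fs i (r : R) (_ : 0 < r) := differentiable_derive1n_cst (sin theta) i r.
set c := cos theta in c0 Sq phiu; set s := sin theta in s0 fs Sq phiu.
have yu : lsubmx (phi u) = c *: x by rewrite phiu row_mxKl.
have cx0 : c *: x != 0 by rewrite scaler_eq0 negb_or gt_eqF.
have Gs := radial_graph_smooth Lharm fs.
have graph : \forall w \near u,
    phi w = row_mx (lsubmx (phi w)) (radial_graph L (cst s) (lsubmx (phi w))).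
  by near=> w; apply: (LO_sphere_graph c0 (US _ _)).1; near: w.
have yy : dot (c *: x) (c *: x) = c ^+ 2 by rewrite dotZl dotZr xx mulr1.
have sph : \forall w \near u, dot (lsubmx (phi w)) (lsubmx (phi w)) =
    dot (lsubmx (phi u)) (lsubmx (phi u)).
  by rewrite yu yy; near=> w; apply: (LO_sphere_graph c0 (US _ _)).2; near: w.
have yuJ : lsubmx (phi u) *m 'J (radial_graph L (cst s)) (lsubmx (phi u)) = 0.
  by rewrite yu (radial_graph_euler Lharm fs c0 x1) derive1_cst mulr0 scale0r.
have yu0 : lsubmx (phi u) != 0 by rewrite yu.
have [P [b []]] := graph_minimal Gs oU phis Uu yu0 graph (Jfree _ Uu) sph yuJ minu.
rewrite yu yy (radial_graph_gram Lsph Lharm fs c0 x1) derive1_cst expr0n scale0r add0r.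
rewrite ME scalerA; set nu := _ * mu => AP HP.
have nu0 : 0 < nu by rewrite mulr_gt0 // exprn_gt0 // divr_gt0.
have QxT : Q *m x^T = 0 by rewrite -[LHS]trmxK trmx_mul trmxK QT xQ trmx0.
(* Multiplying by [Q] determines [Q *m P], and then [P]. *)
have APx : P + nu *: (Q *m P) = 1%:M - x^T *m x.
  rewrite scalemxAl -{1}[P]mul1mx -mulmxDl AP [(c *: x)^T]linearZ.
  rewrite -scalemxAl -scalemxAr !scalerA.
  by rewrite /= -mulrA -expr2 mulVf ?scale1r // expf_neq0 // gt_eqF.
have nu1 : 1 + nu != 0 by rewrite gt_eqF // addr_gt0.
have QP : Q *m P = (1 + nu)^-1 *: Q.
  have := congr1 (fun X => Q *m X) APx.
  rewrite mulmxDr -scalemxAr mulmxA QQ mulmxBr mulmx1 mulmxA QxT mul0mx subr0 => E.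
  by rewrite -[in RHS]E -{2}[Q *m P]scale1r -scalerDl scalerA mulVf // scale1r.
have PE : P = 1%:M - x^T *m x - (nu / (1 + nu)) *: Q.
  by rewrite -APx QP scalerA addrK.
have PT : P^T = P.
  by rewrite PE !linearB linearZ /= trmx1 trmx_mul trmxK QT.
have xP : x *m P = 0 *: x.
  rewrite PE !mulmxBr mulmx1 -scalemxAr xQ scaler0 subr0 mulmxA.
  by rewrite [x *m x^T]mx11_scalar -/(dot x x) xx mul1mx subrr scale0r.
move: HP; rewrite (radial_graph_hess Lharm fs c0 x1 PT xP).
have cst' : (cst s : R -> R)^`()%classic = cst 0.
  by apply/funext => z; rewrite derive1_cst.
rewrite [X in X *: _ + _](_ : _ = 0); last first.
  by rewrite derive1_cst derive1nS derive1n1 cst' derive1_cst; ring.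
rewrite scale0r add0r (hess_contr_ellZ Lharm c0 x1).
rewrite PE !hess_contrB hess_contrZ hess_contr1 (homog_ext_laplacian Lharm x1).
rewrite (hess_contr_radial Lharm x0) subr0.
set T := hess_contr Q _ x; rewrite /radial_graph homog_extZ //.
set K := k%:R * _; rewrite /cst => HT.
(* The coefficient of [T] is non-zero, so [T] is a multiple of [ell x]. *)
pose al := s * c^-2 * (nu / (1 + nu)).
have al0 : al != 0.
  by rewrite !mulf_neq0 ?invr_eq0 ?expf_neq0 // gt_eqF.
have TE : T = (- al^-1 * (b * s + s * c^-2 * K)) *: homog_ext L x.
  have : al *: T = - (b * s + s * c^-2 * K) *: homog_ext L x.
    move: HT; move: T (homog_ext L x) => T e; rewrite !scalerA => HT.
    rewrite scaleNr scalerDl -HT scalerBr !scalerA mulrN -/al scaleNr opprD opprB.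
    by rewrite -addrA addNr addr0 /al; congr (_ *: _); ring.
  move=> /(congr1 (fun X => al^-1 *: X)); rewrite !scalerA mulVf // scale1r => ->.
  by rewrite mulrN mulNr.
have dT : dot (homog_ext L x) T = - (p%:R * mu).
  rewrite (dot_hess_contr Lsph Lharm) // ME -scalemxAr QQ linearZ /= trQ.
  by rewrite mulrC.
rewrite TE; congr (_ *: _); rewrite -dT TE dotZr (dot_homog_ext Lsph) // mulr1.
Unshelve. all: by end_near. Qed.

Lemma LO_image_graph (R : realType) (n m : nat) (L : 'rV[R]_n.+1 -> 'rV[R]_m.+1)
    (f : R -> R) (z : 'rV[R]_(n.+1 + m.+1)) : LO_image f L z -> lsubmx z != 0 ->
  z = row_mx (lsubmx z) (radial_graph L f (lsubmx z)).
Proof.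
move=> [r [x [r0 x1 ->]]]; rewrite /LO_map row_mxKl => rx0.
have r_gt0 : 0 < r.
  by rewrite lt0r r0 andbT; apply: contraNneq rx0 => ->; rewrite scale0r.
exact: radial_graph_point.
Qed.

(** The first component of a point recovers the parameter, so the map is a
    homeomorphism and an immersion.  Over [y != 0] the graph is the relatively open part of the image
    where the first component does not vanish, and a point [y] comes from
    [r = |y|] and [x = y / |y|]. *)
Lemma LO_image_local_param (R : realType) (n m : nat) (L : 'rV[R]_n.+1 -> 'rV[R]_m.+1)
    (k : nat) (f : R -> R) :
  (forall j, spherical_harmonic k (fun x => L x 0 j)) ->
  (forall (i : nat) (r : R), 0 < r -> differentiable (f^`(i)%classic) r) ->
  local_param (LO_image f L) [set y | y != 0] (fun y => row_mx y (radial_graph L f y)).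
Proof.
move=> Lharm fs; set G := radial_graph L f; pose phi y := row_mx y (G y).
have oU : open [set y : 'rV[R]_n.+1 | y != 0] by exact: open_neq0.
have phis : smooth_on_open [set y : 'rV[R]_n.+1 | y != 0] phi.
  apply: (smooth_radial_row fs) => j; rewrite -(splitK j).
  case: (fintype.split j) => i /=.
    by apply: RadExt (RadCoord f i) => y _; rewrite row_mxEl.
  apply: (@RadExt _ _ f _ (fun y => G y 0 i)) => [y _|]; first by rewrite row_mxEr.
  exact: (radial_graph_alg f Lharm).
split=> //.
- move=> y y0.
  have yK : (fun w => lsubmx (phi w)) = id by apply/funext => w; rewrite row_mxKl.
  have dphi := phis [::] y y0.
  rewrite -kermx_eq0; apply/rowV0P => v /sub_kermxP.
  rewrite -deriveEjacobian // => Dv.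
  have := (derive_lsubmx v dphi).2; rewrite Dv yK derive_id => ->.
  by apply/rowP => j; rewrite !mxE.
- exists [set z | lsubmx z != 0].
    apply: (@open_comp _ _ (@lsubmx R 1 n.+1 m.+1) [set y | y != 0]) => // z _.
    exact: differentiable_continuous (differentiable_lsubmx _).
  apply/seteqP; split=> [_ [y y0 <-]|z [Sz z0]].
    split; last by rewrite /= row_mxKl.
    exists (enorm y), ((enorm y)^-1 *: y); split.
    + exact: sqrtr_ge0.
    + exact: sphere_normalize.
    + by rewrite /LO_map scalerA divff ?scale1r // gt_eqF // enorm_gt0.
  by exists (lsubmx z) => //; rewrite /phi -LO_image_graph.
- exists lsubmx; first by move=> y _; rewrite row_mxKl.
  apply: continuous_subspaceT => z.
  exact: differentiable_continuous (differentiable_lsubmx _).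
Qed.

(** With [al = f_r^2 / (1 + f_r^2)] and [be = nu / (1 + nu)], where
    [nu = (f / r)^2 mu], the inverse of the metric is
    [S = 1 - al x^T x - be Q].  Then
    [x S = x / (1 + f_r^2)], the trace of [S] is [n + 1 - al - be p] and
    [hess_contr S ell x = (- p mu + be p mu) ell x]; so both sides are
    multiples of [ell x], a unit vector, and the difference of the factors is
    the left-hand side of the differential equation. *)
Lemma graph_equation (R : realType) (n m p k : nat) (L : 'rV[R]_n.+1 -> 'rV[R]_m.+1)
    (f : R -> R) (C r : R) (x : 'rV[R]_n.+1) :
  (forall (i : nat) (r : R), 0 < r -> differentiable (f^`(i)%classic) r) ->
  LOMSE_of_type p k L -> 0 < r -> sphere x ->
  let mu := k%:R * (n%:R + k%:R - 1) / p%:R in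
  let G := radial_graph L f in let JG := 'J G (r *: x) in
  hess_contr (invmx (1%:M + JG *m JG^T)) G (r *: x)
    = C *: (G (r *: x) - (r *: x) *m JG) <->
  f^`(2)%classic r / (1 + f^`()%classic r ^+ 2)
     + (n%:R - p%:R) * f^`()%classic r / r
     + p%:R * (r * f^`()%classic r - mu * f r) / (r ^+ 2 + mu * f r ^+ 2)
     + C * (r * f^`()%classic r - f r) = 0.
Proof.
move=> fs Ltype r0 x1 mu G JG; have x0 := sphere_neq0 x1.
have [mu0 [Q [QT QQ trQ xQ ME]]] := LOMSE_gram Ltype x1.
have HQ := LOMSE_range_hess Ltype x1 mu0 QT QQ trQ xQ ME.
have [[[theta [[Lsph _] _ _] _] _] _ _ Lharm] := Ltype.
rewrite -/mu in mu0 ME HQ.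
have p0 : p%:R != 0 :> R.
  by apply: contraTneq mu0 => E; rewrite /mu E invr0 mulr0 ltxx.
have Kmu : k%:R * (n%:R + k%:R - 1) = p%:R * mu.
  by rewrite /mu [RHS]mulrC divfK.
set f0 := f r; set f1 := f^`()%classic r; set f2 := f^`(2)%classic r.
pose nu := (f0 / r) ^+ 2 * mu.
have nu0 : 0 <= nu by rewrite mulr_ge0 ?sqr_ge0 ?ltW.
have nu1 : 1 + nu != 0 by rewrite gt_eqF // ltr_wpDr.
have a1 : 1 + f1 ^+ 2 != 0 by rewrite gt_eqF // ltr_wpDr // sqr_ge0.
pose al := f1 ^+ 2 / (1 + f1 ^+ 2); pose be := nu / (1 + nu).
pose X := x^T *m x; pose S := 1%:M - al *: X - be *: Q.
have xx : x *m x^T = 1%:M by rewrite [LHS]mx11_scalar -/(dot x x) dot_sphere.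
have XX : X *m X = X by rewrite /X mulmxA -(mulmxA x^T) xx mulmx1.
have XQ : X *m Q = 0 by rewrite /X -mulmxA xQ mulmx0.
have XT : X^T = X by rewrite trmx_mul trmxK.
have QX : Q *m X = 0 by rewrite -[LHS]trmxK trmx_mul QT XT XQ trmx0.
have WS : (1%:M + JG *m JG^T) *m S = 1%:M.
  rewrite /JG (radial_graph_gram Lsph Lharm fs r0 x1) ME scalerA -/f0 -/f1 -/nu -/X.
  rewrite /S !mulmxBr !mulmx1 -!scalemxAr !mulmxDl !mul1mx -!scalemxAl XX XQ QX QQ.
  rewrite !scaler0 addr0 add0r.
  apply/matrixP => i j; rewrite !mxE /al /be; field.
  by rewrite a1 nu1.
have [WU _] := mulmx1_unit WS.
have -> : invmx (1%:M + JG *m JG^T) = S by rewrite -[RHS](mulKmx WU) WS mulmx1.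
have ST : S^T = S by rewrite /S !linearB !linearZ /= trmx1 XT QT.
have xS : x *m S = (1 - al) *: x.
  rewrite /S !mulmxBr mulmx1 -!scalemxAr xQ scaler0 subr0 /X mulmxA xx mul1mx.
  by rewrite scalerBl scale1r.
have trS : \tr S = n%:R + 1 - al - be * p%:R.
  rewrite /S !linearB !linearZ /= mxtrace1 trQ /X mxtrace_mulC xx mxtrace1.
  by rewrite -natr1 /al /GRing.scale /=; ring.
rewrite /G (radial_graph_hess Lharm fs r0 x1 ST xS) (hess_contr_ellZ Lharm r0 x1).
rewrite /S !hess_contrB !hess_contrZ hess_contr1 (homog_ext_laplacian Lharm x1) Kmu.
rewrite (hess_contr_radial Lharm x0) HQ -/S trS -/f0 -/f1 -/f2.
rewrite /JG (radial_graph_euler Lharm fs r0 x1) /G /radial_graph homog_extZ //.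
rewrite enormZ ?ltW // x1 mulr1 -/f0 -/f1.
have e0 : homog_ext L x != 0 by rewrite sphere_neq0 // homog_ext_sphere //; exact: Lsph.
move: (homog_ext L x) e0 => e e0.
have rn0 : r != 0 by rewrite gt_eqF.
have den : r ^+ 2 + mu * f0 ^+ 2 != 0.
  by rewrite gt_eqF // ltr_pwDl ?exprn_gt0 // mulr_ge0 ?sqr_ge0 // ltW.
set ode := (X in _ <-> X = 0).
rewrite (rwP eqP) -subr_eq0 [X in X == 0](_ : _ = ode *: e); last first.
  by apply/rowP => j; rewrite !mxE /ode /al /be /nu; field; rewrite rn0 a1 den.
by rewrite scaler_eq0 (negPf e0) orbF -(rwP eqP).
Qed.

(** Every local parametrization of the image near a point with [r > 0] takes
    values in the graph, so that [graph_mean_curvature] applies to it. *)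
Lemma LO_image_curvature (R : realType) (n m p k : nat) (L : 'rV[R]_n.+1 -> 'rV[R]_m.+1)
    (f : R -> R) (C r : R) (x : 'rV[R]_n.+1) (U : set 'rV[R]_n.+1)
    (phi : 'rV[R]_n.+1 -> 'rV[R]_(n.+1 + m.+1)) (u : 'rV[R]_n.+1) :
  (forall (i : nat) (r : R), 0 < r -> differentiable (f^`(i)%classic) r) ->
  LOMSE_of_type p k L -> 0 < r -> sphere x ->
  local_param (LO_image f L) U phi -> U u -> phi u = LO_map f L r x ->
  let mu := k%:R * (n%:R + k%:R - 1) / p%:R in
  mean_curvature phi u = C *: normal_proj ('J phi u) (LO_map f L r x) <->
  f^`(2)%classic r / (1 + f^`()%classic r ^+ 2)
     + (n%:R - p%:R) * f^`()%classic r / r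
     + p%:R * (r * f^`()%classic r - mu * f r) / (r ^+ 2 + mu * f r ^+ 2)
     + C * (r * f^`()%classic r - f r) = 0.
Proof.
move=> fs Ltype r0 x1 [oU phis Jfree [V _ imV] _] Uu phiu mu.
have [_ _ _ Lharm] := Ltype.
have yu : lsubmx (phi u) = r *: x by rewrite phiu row_mxKl.
have yu0 : lsubmx (phi u) != 0.
  by rewrite yu scaler_eq0 negb_or gt_eqF // sphere_neq0.
have near_image : \forall w \near u, LO_image f L (phi w).
  have : \forall w \near u, U w by exact: open_nbhs_nbhs.
  apply: filterS => w Uw.
  by have [] : (LO_image f L `&` V) (phi w) by rewrite -imV; exists w.
have near_y0 : \forall w \near u, lsubmx (phi w) != 0.
  have cy : {for u, continuous (fun w => lsubmx (phi w))}.
    by apply: differentiable_continuous; exact: (derive_lsubmx 0 (phis [::] u Uu)).1.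
  apply: (cy [set z | z != 0]); apply: open_nbhs_nbhs; split => //; exact: open_neq0.
have graph : \forall w \near u,
    phi w = row_mx (lsubmx (phi w)) (radial_graph L f (lsubmx (phi w))).
  by apply: filterS2 near_image near_y0 => w; exact: LO_image_graph.
rewrite -{1}phiu; apply: iff_trans (graph_equation C fs Ltype r0 x1).
rewrite -yu; apply: (@graph_mean_curvature _ _ _ _ U) => //; last exact: Jfree.
exact: (radial_graph_smooth Lharm fs).
Qed.

Theorem corollary3p2 (R : realType) (n m p k : nat) (f : R -> R)
    (L : 'rV[R]_n.+1 -> 'rV[R]_m.+1) (C : R)
    (f_smooth : smooth_on [set r : R | 0 <= r] f)
    (f_pos : forall r : R, 0 < r -> 0 < f r)
    (L_type : LOMSE_of_type p k L)
    (C_sign : C = 1 \/ C = -1) :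
  let lambda : R := Num.sqrt (k%:R * (n%:R + k%:R - 1) / p%:R) in
  (forall (r : R) (x : 'rV[R]_n.+1), 0 < r -> sphere x ->
     self_similar_at n.+1 C (LO_image f L) (LO_map f L r x))
  <->
  (forall r : R, 0 < r ->
     f^`(2)%classic r / (1 + f^`()%classic r ^+ 2)
     + (n%:R - p%:R) * f^`()%classic r / r
     + p%:R * (r * f^`()%classic r - lambda ^+ 2 * f r)
         / (r ^+ 2 + lambda ^+ 2 * f r ^+ 2)
     + C * (r * f^`()%classic r - f r) = 0).
Proof.
move=> lambda; have fs := smooth_on_derive1n f_smooth.
have [_ _ _ Lharm] := L_type.
(* The equation for [f] is read off at one point of the sphere. *)
pose e : 'rV[R]_n.+1 := delta_mx 0 0.
have e1 : sphere e.
  rewrite /sphere /= /enorm dotE (bigD1 0) //= big1 ?addr0 ?mxE ?eqxx ?mulr1 ?sqrtr1 //.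
  by move=> i i0; rewrite mxE (negPf i0) andbF mulr0.
have -> : lambda ^+ 2 = k%:R * (n%:R + k%:R - 1) / p%:R.
  by rewrite sqr_sqrtr // ltW //; exact: (LOMSE_gram L_type e1).1.
split=> [selfsim r r0|ode r x r0 x1].
  have [[U [phi [u [param Uu phiu]]]] curv] := selfsim r e r0 e1.
  exact: (LO_image_curvature C fs L_type r0 e1 param Uu phiu).1 (curv _ _ _ param Uu phiu).
split=> [|U phi u param Uu phiu].
  exists [set y | y != 0], (fun y => row_mx y (radial_graph L f y)), (r *: x).
  split; first exact: (LO_image_local_param Lharm fs).
    by rewrite /= scaler_eq0 negb_or gt_eqF // sphere_neq0.
  by rewrite -radial_graph_point.
exact: (LO_image_curvature C fs L_type r0 x1 param Uu phiu).2 (ode r r0).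
Qed.
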